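(* Let $\epsilon=(\epsilon_y)_{y\in\mathbb{Z}}$ be a sequence of independent random variables with $\mathbb{P}(\epsilon_y=1)=\mathbb{P}(\epsilon_y=-1)=1/2$. Then for almost every realisation of $\epsilon$, the simple random walk $(M_n)_{n\ge0}$ on the $\epsilon$-horizontally oriented lattice is transient and its speed is $0$, i.e. $\lim_{n\to\infty} M_n/n=(0,0)$ almost surely.
   Context: Given a $\{-1,1\}$-valued sequence $\epsilon=(\epsilon_y)_{y\in\mathbb{Z}}$, the $\epsilon$-horizontally oriented lattice is the directed graph with vertex set $\mathbb{Z}^2$ in which there is an oriented edge from $u=(u_1,u_2)$ to $v=(v_1,v_2)$ if and only if either $v_1=u_1$ and $v_2=u_2\pm 1$, or $v_2=u_2$ and $v_1=u_1+\epsilon_{u_2}$. Thus vertical edges can be used in both directions, each horizontal line is one-way, and every vertex has exactly $3$ outgoing edges. For a fixed realisation of $\epsilon$, the simple random walk on this graph is the $\mathbb{Z}^2$-valued Markov chain $(M_n)_{n\ge 0}$ started at $M_0=(0,0)$ that at each step follows one of the $3$ outgoing edges of its current position with probability $1/3$ each. Transience is meant in the usual sense for Markov chains, for the chain with $\epsilon$ fixed. *)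

(* Defs.v *)
From HB Require Import structures.
From mathcomp Require Import all_boot all_order all_algebra.
From mathcomp Require Import finmap.
From mathcomp Require Import all_classical all_reals all_analysis.
Import Order.TTheory GRing.Theory Num.Theory.
Import numFieldNormedType.Exports.

Set Implicit Arguments.
Unset Strict Implicit.
Unset Printing Implicit Defensive.

Local Open Scope classical_set_scope.
Local Open Scope ring_scope.

(* [int] carries the discrete sigma-algebra; since [int] is countable, the
   product sigma-algebra on [int * int] is then discrete as well. *)
HB.instance Definition _ := isPointed.Build int 0.
HB.instance Definition _ := @isMeasurable.Build default_measure_display
  int discrete_measurable discrete_measurable0
  discrete_measurableC discrete_measurableU.

Definition mutually_independent (R : realType) (d d' : measure_display)
    (T : measurableType d) (S : measurableType d') (P : probability T R)
    (I : choiceType) (X : I -> {RV P >-> S}) : Prop :=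
  forall (J : {fset I}) (A : I -> set S), (forall i, measurable (A i)) ->
    P (\bigcap_(i in [set` J]) (X i @^-1` A i)) =
    (\prod_(i <- J) P (X i @^-1` A i))%E.

(* Time-homogeneous Markov chain with transition probabilities [p], started at
   [x].  The Markov property is in product form, which avoids conditioning on
   null events; it is meant for a countable [S] with measurable singletons. *)
Definition markov_chain (R : realType) (d d' : measure_display)
    (T : measurableType d) (S : measurableType d') (P : probability T R)
    (p : S -> S -> R) (x : S) (M : nat -> {RV P >-> S}) : Prop :=
  P [set t | M 0%N t = x] = 1%E /\
  forall (n : nat) (v : nat -> S),
    P [set t | forall k, (k <= n.+1)%N -> M k t = v k] =
    (P [set t | forall k, (k <= n)%N -> M k t = v k]
      * (p (v n) (v n.+1))%:E)%E.

(* The law of a Markov chain is determined by [p] and [x], so quantifying over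
   all its realisations expresses P_x(return to x) < 1. *)
Definition transient_state (R : realType) (d' : measure_display)
    (S : measurableType d') (p : S -> S -> R) (x : S) : Prop :=
  forall (d : measure_display) (T : measurableType d) (P : probability T R)
    (M : nat -> {RV P >-> S}),
    markov_chain p x M -> (P [set t | exists n, M n.+1 t = x] < 1)%E.

Definition transient (R : realType) (d' : measure_display)
    (S : measurableType d') (p : S -> S -> R) : Prop :=
  forall x : S, transient_state p x.

Definition oriented_edge (eps : int -> int) : rel (int * int) := fun u v =>
  ((v.1 == u.1) && ((v.2 == u.2 + 1) || (v.2 == u.2 - 1)))
  || ((v.2 == u.2) && (v.1 == u.1 + eps u.2)).

Definition srw_transition (R : realType) (eps : int -> int)
    (u v : int * int) : R :=
  if oriented_edge eps u v then 3^-1 else 0.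

(* Main.v *)
(* With the vertical coordinate fixed, the horizontal displacement is a signed sum, so everything is
   averaged over the environment first and transferred to almost every environment by a convergent
   series of nonnegative functions.  Averages over the walk are averages over words in the letters
   [1], [-1], [0] (up, down, horizontal step), averages over the environment are averages over words
   of signs on a finite window of heights.

   Transience: cut a word into its vertical part [v], of length [m], and the horizontal runs at the
   [m + 1] visited sites.  If [K] of these sites carry the sign [+], the runs contribute
   [Phi K (m + 1 - K)], the probability, up to a factor, that two negative binomial variables
   agree.  [Phi] is unimodal in [K], with maximum of order [m^(-1/2)] and bounded sum, while
   [K = sum_y 1(eps_y = 1) occ_y] is spread out over windows of length [L = m^(1/2 - 1/12)] by the
   Littlewood-Offord inequality, because with high probability at least [m^(1/3)] sites are visited
   more than [L] times.  Together with the factor [m^(-1/2)] for returning to the initial height,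
   this gives a term [m^(-1 - 1/12)], which is summable.  Finiteness of the expected number of
   visits bounds the escape probability below, by decomposing at the last visit.

   Speed: the averaged second moment of the displacement after [n] steps is at most the expected
   sum of squared occupation times, which is [O(n^(3/2))].  This is summable along [n = k^4] after
   division by [n^2], and the increments are bounded. *)

Require Import Defs.
From mathcomp Require Import all_boot all_order all_algebra.
From mathcomp Require Import finmap.
From mathcomp Require Import all_classical all_reals all_analysis.
From mathcomp Require Import measurable_realfun.
From mathcomp Require Import zify ring lra.
Import Order.TTheory GRing.Theory Num.Theory.
Import numFieldNormedType.Exports.

Set Implicit Arguments.
Unset Strict Implicit.
Unset Printing Implicit Defensive.

Local Open Scope classical_set_scope.
Local Open Scope ring_scope.

(** * Averages over words *)

Fixpoint words (T : Type) (A : seq T) (n : nat) : seq (seq T) :=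
  if n is n'.+1 then [seq s :: w | s <- A, w <- words A n'] else [:: [::]].

Definition mean (R : realFieldType) (T : Type) (A : seq T) (n : nat)
    (F : seq T -> R) : R :=
  (\sum_(w <- words A n) F w) / (size A)%:R ^+ n.

Section Words.
Variables (R : realFieldType) (T : eqType) (A : seq T).
Implicit Types (F G : seq T -> R).

Lemma mem_words n w : (w \in words A n) = (size w == n) && all (mem A) w.
Proof.
elim: n w => [|n IH] [|s w] //=; first by apply/allpairsP => -[] [? ?] [].
rewrite eqSS; apply/allpairsP/idP => [[[s' w'] /= [sA wn [-> ->]]]|].
  by move: wn; rewrite IH => /andP[-> ->]; rewrite sA.
by case/and3P=> sw sA wA; exists (s, w); split => //=; rewrite IH sw.
Qed.

Lemma size_words n : size (words A n) = (size A ^ n)%N.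
Proof. by elim: n => //= n IH; rewrite size_allpairs IH expnS. Qed.

Lemma words_uniq n : uniq A -> uniq (words A n).
Proof.
move=> uA; elim: n => //= n IH; apply: allpairs_uniq => //.
by move=> [? ?] [? ?] _ _ /= [-> ->].
Qed.

Lemma big_words_S (n : nat) (F : seq T -> R) :
  \sum_(w <- words A n.+1) F w = \sum_(s <- A) \sum_(w <- words A n) F (s :: w).
Proof. by rewrite /= big_allpairs_dep. Qed.

Lemma big_words_cat (n k : nat) F :
  \sum_(w <- words A (n + k)) F w =
  \sum_(w1 <- words A n) \sum_(w2 <- words A k) F (w1 ++ w2).
Proof.
elim: n F => [|n IH] F; first by rewrite big_seq1.
rewrite addSn !big_words_S; apply: eq_bigr => s _.
by rewrite IH.
Qed.

Hypothesis A0 : (0 < size A)%N.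
Local Notation E := (@mean R T A).

Let sA0 : (size A)%:R != 0 :> R. Proof. by rewrite pnatr_eq0 -lt0n. Qed.
Let sAgt0 : 0 < (size A)%:R :> R. Proof. by rewrite ltr0n. Qed.

Lemma mean0 F : E 0 F = F [::].
Proof. by rewrite /mean /= big_seq1 expr0 divr1. Qed.

Lemma meanS n F : E n.+1 F = (\sum_(s <- A) E n (fun w => F (s :: w))) / (size A)%:R.
Proof.
by rewrite /mean big_words_S -mulr_suml exprSr invfM mulrA.
Qed.

Lemma mean_cat n k F : E (n + k) F = E n (fun w1 => E k (fun w2 => F (w1 ++ w2))).
Proof.
rewrite /mean big_words_cat -mulr_suml exprD invfM.
by rewrite -!mulrA [_^-1 * _^-1]mulrC.
Qed.

Lemma eq_mean n F G : {in words A n, F =1 G} -> E n F = E n G.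
Proof. by move=> FG; rewrite /mean (eq_big_seq _ FG). Qed.

Lemma le_mean n F G : {in words A n, forall w, F w <= G w} -> E n F <= E n G.
Proof.
move=> FG; rewrite /mean ler_pM2r ?invr_gt0 ?exprn_gt0 //.
by rewrite big_seq [leRHS]big_seq; apply: ler_sum.
Qed.

Lemma mean_ge0 n F : {in words A n, forall w, 0 <= F w} -> 0 <= E n F.
Proof.
move=> F0; rewrite /mean divr_ge0 ?exprn_ge0 ?ler0n // big_seq.
by apply: sumr_ge0.
Qed.

Lemma meanD n F G : E n (fun w => F w + G w) = E n F + E n G.
Proof. by rewrite /mean big_split mulrDl. Qed.

Lemma meanZ n c F : E n (fun w => c * F w) = c * E n F.
Proof. by rewrite /mean -mulr_sumr mulrA. Qed.

Lemma meanZr n c F : E n (fun w => F w * c) = E n F * c.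
Proof. by rewrite /mean -mulr_suml mulrAC. Qed.

Lemma mean_sum n (I : Type) (r : seq I) (P : pred I) (H : I -> seq T -> R) :
  E n (fun w => \sum_(i <- r | P i) H i w) = \sum_(i <- r | P i) E n (H i).
Proof. by rewrite /mean exchange_big /= mulr_suml. Qed.

Lemma mean_const n c : E n (fun=> c) = c.
Proof.
rewrite /mean big_const_seq count_predT size_words iter_addr addr0.
by rewrite -[c *+ (_ ^ _)%N]mulr_natr natrX mulfK ?expf_neq0.
Qed.

Lemma mean_leC n F c : {in words A n, forall w, F w <= c} -> E n F <= c.
Proof. by move=> Fc; rewrite -[leRHS](mean_const n c); apply: le_mean. Qed.

End Words.

(** * Height trajectories and occupation times *)

Fixpoint heights (z : int) (w : seq int) : seq int :=
  if w is s :: w' then z :: heights (z + s) w' else [:: z].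

Definition height (w : seq int) : int := \sum_(s <- w) s.

(** Both endpoints of the trajectory count, so a word of length [m] makes [m + 1] visits in all, one
    for each slot that can receive a horizontal run. *)
Definition occ (z : int) (w : seq int) (y : int) : nat := count_mem y (heights z w).

Definition srw_steps : seq int := [:: 1; -1].

(* The letter [0] stands for a horizontal step of the walk on the oriented lattice. *)
Definition lazy_steps : seq int := [:: 1; -1; 0].

Lemma height_cons s w : height (s :: w) = s + height w.
Proof. by rewrite /height big_cons. Qed.

Lemma height_nil : height [::] = 0.
Proof. by rewrite /height big_nil. Qed.

Lemma height_cat v w : height (v ++ w) = height v + height w.
Proof. by rewrite /height big_cat. Qed.

Lemma size_heights z w : size (heights z w) = (size w).+1.
Proof. by elim: w z => //= s w IH z; rewrite IH. Qed.

Lemma normz_step (y : int) :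
  `|y + 1| + `|y - 1| = 2 * `|y| + 2 * (y == 0)%:R :> int.
Proof. case: (eqVneq y 0) => [->|y0] //=; lia. Qed.

(** * Height moments and occupation times, for the simple and the lazy alphabet at once *)

Section Walk.
Variables (R : realFieldType) (A : seq int).
Hypothesis stepA : A = srw_steps \/ A = lazy_steps.
Local Notation E := (@mean R int A).

Let A0 : (0 < size A)%N. Proof. by case: stepA => ->. Qed.
Let sA0 : (size A)%:R != 0 :> R. Proof. by rewrite pnatr_eq0 -lt0n. Qed.
Let sAgt0 : 0 < (size A)%:R :> R. Proof. by rewrite ltr0n. Qed.

Lemma steps_abs (y : int) :
  \sum_(s <- A) `|(y + s)%:~R| = (size A)%:R * `|y%:~R| + 2 * (y == 0)%:R :> R.
Proof.
have H := normz_step y.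
have H' : `|(y + 1)%:~R| + `|(y - 1)%:~R| = 2 * `|y%:~R| + 2 * (y == 0)%:R :> R.
  rewrite -!intr_norm.
  have -> : 2 * `|y|%:~R + 2 * (y == 0)%:R = (2 * `|y| + 2 * (y == 0)%:R)%:~R :> R.
    by rewrite rmorphD /= !rmorphM /= !rmorph_nat.
  by rewrite -H intrD.
case: stepA => ->; rewrite /srw_steps /lazy_steps !big_cons big_nil !addr0.
  by rewrite H'.
by rewrite addrA H' /=; ring.
Qed.

Lemma steps_sqr (x : R) :
  \sum_(s <- A) (x + s%:~R) ^+ 2 = (size A)%:R * x ^+ 2 + 2.
Proof.
case: stepA => ->; rewrite /srw_steps /lazy_steps !big_cons big_nil /=; ring.
Qed.

Lemma mean_sqr_height n (x : R) :
  E n (fun w => (x + (height w)%:~R) ^+ 2) = x ^+ 2 + 2 / (size A)%:R * n%:R.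
Proof.
elim: n x => [|n IH] x; first by rewrite mean0 height_nil; ring.
rewrite meanS.
rewrite (eq_bigr (fun s => (x + s%:~R) ^+ 2 + 2 / (size A)%:R * n%:R)); last first.
  move=> s _; rewrite -IH; apply: eq_mean => w _.
  by rewrite height_cons intrD addrA.
rewrite big_split /= steps_sqr big_const_seq count_predT iter_addr addr0.
rewrite -[_ *+ size A]mulr_natl -[n.+1%:R]natr1; field; exact: sA0.
Qed.

(* Discrete Tanaka formula: the expected occupation of [y] is the drift of [|z - y|]. *)
Lemma mean_occ_tanaka n (z y : int) :
  2 / (size A)%:R * E n (fun w => (occ z w y)%:R) =
  E n.+1 (fun w => `|(z + height w - y)%:~R|) - `|(z - y)%:~R|.
Proof.
elim: n z => [|n IH] z.
  rewrite meanS mean0 /occ /= addn0.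
  rewrite (eq_bigr (fun s => `|(z - y + s)%:~R|)); last first.
    by move=> s _; rewrite mean0 height_cons height_nil addr0 addrAC.
  by rewrite steps_abs subr_eq0; field; exact: sA0.
rewrite meanS [in RHS]meanS.
have -> : \sum_(s <- A) E n (fun w => (occ z (s :: w) y)%:R) =
   (size A)%:R * (z == y)%:R + \sum_(s <- A) E n (fun w => (occ (z + s) w y)%:R) :> R.
  rewrite (eq_bigr (fun s => (z == y)%:R + E n (fun w => (occ (z + s) w y)%:R))).
    by rewrite big_split /= big_const_seq count_predT iter_addr addr0 -[_ *+ size A]mulr_natl.
  move=> s _; rewrite -[X in X + _](mean_const A0 n) -meanD.
  by apply: eq_mean => w _; rewrite /occ /= natrD.
transitivity (2 / (size A)%:R * (z == y)%:R + (\sum_(s <- A)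
    2 / (size A)%:R * E n (fun w => (occ (z + s) w y)%:R)) / (size A)%:R).
  by rewrite -mulr_sumr; field; exact: sA0.
rewrite (eq_bigr (fun s => E n.+1 (fun w => `|(z + height (s :: w) - y)%:~R|)
    - `|(z - y + s)%:~R|)); last first.
  move=> s _; rewrite IH; congr (_ - `|_%:~R|); last by rewrite addrAC.
  by apply: eq_mean => w _; rewrite height_cons !addrA.
rewrite sumrB steps_abs subr_eq0; field; exact: sA0.
Qed.

(** Tanaka's formula reduces the occupation to the mean of [|height w|], and
    [|a| <= a^2 / (2c) + c / 2] reduces that to the variance. The free parameter [c] stands for the
    square root of [n]. *)
Lemma mean_occ_le n (z y : int) (c : R) : 0 < c ->
  E n (fun w => (occ z w y)%:R) <= n.+1%:R / c + c.
Proof.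
move=> c0.
have [k k23 /andP[kgt0 kle3]] : exists2 k : R, k = (size A)%:R & 0 < k <= 3.
  by exists (size A)%:R => //; case: stepA => ->; rewrite /= ltr0n ler_nat.
have le1 : 2 / k * E n (fun w => (occ z w y)%:R) <=
    E n.+1 (fun w => `|(height w)%:~R|).
  rewrite k23 mean_occ_tanaka -[X in _ - X](mean_const A0 n.+1).
  rewrite lerBlDr -meanD; apply: le_mean => // w _.
  by rewrite [z + height w]addrC -addrA [(height w + _)%:~R]intrD ler_normD.
have le2 : E n.+1 (fun w => `|(height w)%:~R|) <=
    (2 * c)^-1 * (2 / k * n.+1%:R) + c / 2.
  have <- : E n.+1 (fun w => (0 + (height w)%:~R) ^+ 2) = 2 / k * n.+1%:R.
    by rewrite mean_sqr_height k23 expr0n add0r.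
  rewrite -meanZ -[X in _ <= _ + X](mean_const A0 n.+1) -meanD.
  apply: le_mean => // w _; rewrite add0r -real_normK ?num_real //.
  move: `|_| => a; rewrite -(ler_pM2l (x := 2 * c)) ?mulr_gt0 //.
  have -> : 2 * c * ((2 * c)^-1 * a ^+ 2 + c / 2) = a ^+ 2 + c ^+ 2.
    by field; rewrite lt0r_neq0.
  have := sqr_ge0 (a - c); nra.
have {le1 le2} := le_trans le1 le2.
rewrite -(ler_pM2l (x := k / 2)) ?divr_gt0 //.
have -> : k / 2 * (2 / k * E n (fun w => (occ z w y)%:R)) = E n (fun w => (occ z w y)%:R).
  by field; rewrite lt0r_neq0.
move=> /le_trans; apply.
have -> : k / 2 * ((2 * c)^-1 * (2 / k * n.+1%:R) + c / 2) =
   n.+1%:R / c / 2 + k / 4 * c.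
  by field; rewrite !lt0r_neq0.
have : 0 <= n.+1%:R / c by rewrite divr_ge0 // ltW.
nra.
Qed.

End Walk.

Section WalkMoments.
Variables (R : realFieldType) (A : seq int).
Hypothesis stepA : A = srw_steps \/ A = lazy_steps.
Local Notation E := (@mean R int A).

Let A0 : (0 < size A)%N. Proof. by case: stepA => ->. Qed.
Let sA0 : (size A)%:R != 0 :> R. Proof. by rewrite pnatr_eq0 -lt0n. Qed.
Let sAgt0 : 0 < (size A)%:R :> R. Proof. by rewrite ltr0n. Qed.

Let avg_le (f : int -> R) (c : R) : (forall s, f s <= c) ->
  (\sum_(s <- A) f s) / (size A)%:R <= c.
Proof.
move=> fc; rewrite ler_pdivrMr //.
apply: (@le_trans _ _ (\sum_(s <- A) c)); first exact: ler_sum.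
by rewrite big_const_seq count_predT iter_addr addr0 mulr_natr.
Qed.

(** Prepending the site [z] raises the sum of squares by at most [1 + 2 * occ (z + s) w z], whose
    mean is controlled by [mean_occ_le]. The horizon [N] is separate from [n] so that this increment
    stays constant during the induction. *)
Lemma mean_energy_le (n N : nat) (W : seq int) (z : int) (c : R) :
  uniq W -> 0 < c -> (n <= N)%N ->
  E n (fun w => \sum_(y <- W) (occ z w y)%:R ^+ 2) <=
  n.+1%:R * (1 + 2 * (N.+1%:R / c + c)).
Proof.
move=> uW c0; elim: n z => [|n IH] z nN.
  have B0 : 0 <= N.+1%:R / c by rewrite divr_ge0 // ltW.
  rewrite mean0 mul1r /occ /=.
  have : \sum_(y <- W) ((z == y) + 0)%N%:R ^+ 2 <= 1 :> R; last by lra.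
  under eq_bigr do rewrite addn0.
  rewrite (eq_bigr (fun y => (if z == y then 1 else 0 : R))); last first.
    by move=> y _; case: eqP; rewrite ?expr1n ?expr0n.
  rewrite -big_mkcond big_const_seq iter_addr addr0.
  rewrite (eq_count (a2 := pred1 z)); last by move=> y; rewrite /= eq_sym.
  rewrite count_uniq_mem //.
  by case: (z \in W); rewrite /= ?lexx ?ler01.
rewrite meanS; apply: avg_le => s.
have nN' := ltnW nN.
have -> : n.+2%:R * (1 + 2 * (N.+1%:R / c + c)) = (1 + 2 * (N.+1%:R / c + c)) +
   n.+1%:R * (1 + 2 * (N.+1%:R / c + c)).
  by rewrite -[n.+2%:R]natr1; ring.
apply: le_trans (lerD (lexx _) (IH (z + s) nN')); rewrite -lerBlDr.
have : E n (fun w => (occ (z + s) w z)%:R) <= N.+1%:R / c + c.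
  apply: le_trans (mean_occ_le stepA n (z + s) z c0) _.
  by rewrite lerD2r ler_pM2r ?invr_gt0 // ler_nat ltnS.
suff : E n (fun w => \sum_(y <- W) (occ z (s :: w) y)%:R ^+ 2) <=
  E n (fun w => 1 + (2 * (occ (z + s) w z)%:R + \sum_(y <- W) (occ (z + s) w y)%:R ^+ 2)).
  by rewrite !meanD meanZ mean_const //; lra.
apply: le_mean => // w _; rewrite addrA -lerBlDr -sumrB.
rewrite (eq_bigr (fun y => (if z == y then 1 + 2 * (occ (z + s) w z)%:R else 0 : R))); last first.
  move=> y _; rewrite /occ /=; case: eqP => [->|_] /=; last by rewrite add0n subrr.
  by rewrite natrD; ring.
rewrite -big_mkcond big_const_seq iter_addr addr0.
rewrite (eq_count (a2 := pred1 z)); last by move=> y; rewrite /= eq_sym.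
rewrite count_uniq_mem //.
by case: (z \in W); rewrite ?mulr1n ?mulr0n ?lexx // addr_ge0 ?mulr_ge0.
Qed.

(** The mean squared displacement grows by [2 / size A <= 1] per step. The reference height [z0]
    stays fixed while the start [z] moves in the induction. *)
Lemma mean_spread_le (n : nat) (z z0 : int) :
  E n (fun w => \sum_(p <- heights z w) (p - z0)%:~R ^+ 2) <=
  n.+1%:R * ((z - z0)%:~R ^+ 2 + n%:R).
Proof.
elim: n z => [|n IH] z; first by rewrite mean0 /= big_seq1 mul1r addr0.
rewrite meanS.
set d : R := (z - z0)%:~R.
apply: (@le_trans _ _ ((\sum_(s <- A)
   (d ^+ 2 + n.+1%:R * n%:R + n.+1%:R * (d + s%:~R) ^+ 2)) / (size A)%:R)).
  rewrite ler_pM2r ?invr_gt0 //; apply: ler_sum => s _.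
  rewrite (eq_mean (G := fun w => d ^+ 2 + \sum_(p <- heights (z + s) w) (p - z0)%:~R ^+ 2)).
    rewrite meanD mean_const // -addrA lerD2l (le_trans (IH _)) //.
    by rewrite addrAC [(z - z0 + s)%:~R]intrD mulrDr addrC.
  by move=> w _ /=; rewrite big_cons.
rewrite big_split /= big_const_seq count_predT iter_addr addr0 -[_ *+ size A]mulr_natr.
rewrite -mulr_sumr (steps_sqr stepA) ler_pdivrMr //.
have [k -> k2] : exists2 k : R, (size A)%:R = k & 2 <= k.
  by exists (size A)%:R => //; case: stepA => ->; rewrite /= ler_nat.
rewrite -[n.+2%:R]natr1 -[n.+1%:R]natr1; have : 0 <= n%:R :> R by [].
move: n%:R => m m0.
rewrite -subr_ge0 (_ : _ - _ = (m + 1) * (k * 2 - 2)); last by ring.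
by rewrite mulr_ge0; lra.
Qed.

End WalkMoments.

(** * Littlewood-Offord inequality *)

(** The summand [odd n] makes the induction close. From odd [n] the factor [n.+1 + odd n] does not
    change and the coefficient at most doubles; from even [n] what is needed is
    [(n + 1) * (n + 3) <= (n + 2)^2]. *)
Lemma bin_sqr_le (n k : nat) : ('C(n, k) ^ 2 * (n.+1 + odd n) <= 4 ^ n)%N.
Proof.
elim: n k => [|n IH] k; first by rewrite bin0n; case: eqP.
(* One of [n + 1 - k] and [k] is at least [(n + 1) / 2] rounded up; it is taken as [t], and
   absorption compares the coefficient with one of order [n]. *)
have [c' [t [htc hIH ht]]] : exists c' t, [/\ (t * 'C(n.+1, k) = n.+1 * c')%N,
    (c' ^ 2 * (n.+1 + odd n) <= 4 ^ n)%N & (n.+1 + odd n.+1 <= 2 * t)%N].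
  have [hk|hk] := leqP (n.+1 + odd n.+1) (2 * (n.+1 - k)).
    exists 'C(n, k), (n.+1 - k)%N; split => //.
    by rewrite -(mul_bin_down n.+1).
  have k0 : (0 < k)%N by case: k hk => // /=; have := odd_double_half n; lia.
  exists 'C(n, k.-1), k; split => //.
    by have := mul_bin_diag n.+1 k.-1; rewrite prednK.
  have := odd_double_half n; move: hk => /=; case: (odd n) => /=; lia.
rewrite [(4 ^ n.+1)%N]expnS; move: 'C(n.+1, k) htc => c htc; move: (4 ^ n)%N hIH => X hIH.
move: hIH ht => /=; case: (odd n) => /= hIH ht.
  have cc' : (c <= 2 * c')%N.
    rewrite -(leq_pmul2l (ltn0Sn n)) mulnCA -htc mulnA leq_mul2r.
    by apply/orP; right; rewrite addn0 in ht.
  have : (c ^ 2 <= (2 * c') ^ 2)%N by rewrite leq_sqr.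
  rewrite expnMn => h; rewrite addn0.
  apply: leq_trans (leq_mul h (leqnn _)) _.
  rewrite -mulnA. by apply: (leq_mul (leqnn 4)); move: hIH; rewrite addn1.
rewrite -(leq_pmul2l (ltn0Sn n)).
have : ((n.+2 * c) ^ 2 <= (2 * t * c) ^ 2)%N by rewrite leq_sqr leq_mul2r; apply/orP; right; lia.
have -> : (2 * t * c)%N = (2 * (n.+1 * c'))%N by rewrite -mulnA htc.
by move: hIH; rewrite !expnS !expn0; nia.
Qed.

(** Here and below an integer [q] with a bound on [q ^ 2] replaces a square root. *)
Lemma bin_le_div (n k q : nat) : (q ^ 2 <= n.+1)%N -> (q * 'C(n, k) <= 2 ^ n)%N.
Proof.
move=> qn; rewrite -leq_sqr expnMn -expnM [(n * 2)%N]mulnC expnM mulnC.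
apply: leq_trans (bin_sqr_le n k); rewrite leq_mul2l; apply/orP; right; lia.
Qed.

(* The number of [k]-step simple walks started at [j] that stay positive, equivalently the sum of
   the [j] largest binomial coefficients of order [k]. *)
Definition top_bin (k j : nat) : nat :=
  (\sum_(i < k.+1) ((k <= 2 * i + j) && (2 * i < k + j)) * 'C(k, i))%N.

(** First step of the walk started at [j + 1]. On the binomial side, Pascal's rule leaves two
    shifted index ranges, which are exchanged for their union and their intersection. *)
Lemma top_bin_rec (k j : nat) :
  top_bin k.+1 j.+1 = (top_bin k j.+2 + top_bin k j)%N.
Proof.
pose ind k j i := nat_of_bool ((k <= 2 * i + j) && (2 * i < k + j))%N.
have -> : top_bin k.+1 j.+1 = (\sum_(i < k.+1) (ind k.+1 j.+1 i + ind k.+1 j.+1 i.+1) * 'C(k, i))%N.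
  rewrite /top_bin big_ord_recl.
  rewrite (eq_bigr (fun i : 'I_k.+1 => ind k.+1 j.+1 i.+1 * 'C(k, i.+1) +
     ind k.+1 j.+1 i.+1 * 'C(k, i))%N); last by move=> i _; rewrite -mulnDr.
  rewrite big_split /= addnA; under [in RHS]eq_bigr do rewrite mulnDl.
  rewrite big_split /=; congr (_ + _)%N.
  rewrite big_ord_recr /= (bin_small (ltnSn k)) (muln0 (ind _ _ _)) addn0.
  by rewrite [RHS]big_ord_recl !bin0.
rewrite /top_bin -big_split /=; apply: eq_bigr => i _; rewrite -mulnDl; congr (_ * _)%N.
by rewrite /ind; do ![case: leqP => ? /=]; lia.
Qed.

Lemma top_bin1 (k : nat) : top_bin k 1 = 'C(k, k./2).
Proof.
have hk : (k./2 < k.+1)%N by have := odd_double_half k; lia.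
rewrite /top_bin (bigD1 (Ordinal hk)) //= big1 ?addn0 => [|i].
  by have := odd_double_half k => ?; rewrite (_ : _ && _ = true) ?mul1n //; lia.
rewrite -val_eqE /= => ik; rewrite (_ : _ && _ = false) ?mul0n //.
by have := odd_double_half k; move: ik; lia.
Qed.

Fixpoint subset_sum (b : seq bool) (a : seq nat) : nat :=
  match b, a with
  | e :: b', x :: a' => e * x + subset_sum b' a'
  | _, _ => 0
  end.

Lemma subset_sum_le b a : (subset_sum b a <= sumn a)%N.
Proof.
elim: a b => [|x a' IH] [|e b] //=.
by apply: leq_add => //; case: e; rewrite ?mul1n.
Qed.

Definition hits (L : nat) (T : seq int) (x : int) : nat :=
  count (fun t => t <= x < t + L%:Z) T.

Arguments hits : simpl never.

Section LittlewoodOfford.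
Variables (R : realFieldType) (L : nat).
Local Notation E := (@mean R bool [:: true; false]).

Definition spread : rel int := fun t t' => t + L%:Z <= t'.

Lemma spread_trans : transitive spread.
Proof. by move=> y x z; rewrite /spread; lia. Qed.

Lemma hits_cons t (T : seq int) (x : int) :
  hits L (t :: T) x = ((t <= x < t + L%:Z)%R + hits L T x)%N.
Proof. by []. Qed.

Lemma hits_le1 (T : seq int) (x : int) :
  sorted spread T -> (hits L T x <= (0 < size T))%N.
Proof.
elim: T => // t T IH /= sT; have sT' := path_sorted sT.
have [tx|tx] := boolP (t <= x < t + L%:Z); last first.
  by rewrite hits_cons (negbTE tx) add0n (leq_trans (IH sT')) // leq_b1.
rewrite hits_cons tx (_ : hits L T x = 0%N) // /hits; apply/eqP; rewrite -leqn0 leqNgt -has_count.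
apply/hasPn => t' t'T; have := allP (order_path_min spread_trans sT) t' t'T.
by rewrite /spread; lia.
Qed.

Lemma hits_shift (T : seq int) (x a : int) :
  hits L T (x + a) = hits L [seq t - a | t <- T] x.
Proof. by rewrite /hits count_map; apply: eq_count => t /=; lia. Qed.

Lemma sorted_spread_shift (T : seq int) (a : int) :
  sorted spread T -> sorted spread [seq t - a | t <- T].
Proof.
by rewrite sorted_map; apply: sub_sorted => t t'; rewrite /spread /=; lia.
Qed.

(* Kleitman's form of the Littlewood-Offord inequality: a weight at least [L] moves the leftmost
   window of [T - x] off the windows of [T], which trades two families of [j] windows for families
   of [j + 1] and [j - 1]; this is the recursion of [top_bin]. *)
Lemma littlewood_offord_windows (a : seq nat) (T : seq int) :
  sorted spread T ->
  E (size a) (fun b => (hits L T (subset_sum b a)%:Z)%:R) <=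
  (top_bin (count (leq L) a) (size T))%:R / 2 ^+ count (leq L) a.
Proof.
elim: a T => [|x a IH] T sT.
  rewrite mean0 /= expr0 divr1 ler_nat (leq_trans (hits_le1 _ sT)) //.
  by rewrite /top_bin big_ord1 bin0; case: (size T).
rewrite meanS !big_cons big_nil addr0.
have -> : E (size a) (fun w => (hits L T (subset_sum (false :: w) (x :: a))%:Z)%:R) =
  E (size a) (fun w => (hits L T (subset_sum w a)%:Z)%:R).
  by apply: eq_mean => w _ /=; rewrite add0n.
have -> : E (size a) (fun w => (hits L T (subset_sum (true :: w) (x :: a))%:Z)%:R) =
  E (size a) (fun w => (hits L [seq t - x%:Z | t <- T] (subset_sum w a)%:Z)%:R).
  by apply: eq_mean => w _ /=; rewrite mul1n addnC PoszD hits_shift.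
rewrite ler_pdivrMr //=.
have [Lx|Lx] := leqP L x; last first.
  have := IH _ sT; have := IH _ (sorted_spread_shift x sT); rewrite size_map; lra.
case: T sT => [|t T] sT.
  rewrite !(eq_mean (G := fun=> 0)) // mean_const // addr0.
  by rewrite mulr_ge0 ?divr_ge0 ?exprn_ge0.
rewrite -meanD (eq_mean (G := fun w =>
    (hits L ((t - x%:Z) :: t :: T) (subset_sum w a)%:Z)%:R +
    (hits L [seq t - x%:Z | t <- T] (subset_sum w a)%:Z)%:R)); last first.
  by move=> w _; rewrite -!natrD /= !hits_cons; congr (_%:R); ring.
rewrite meanD.
have h1 : sorted spread ((t - x%:Z) :: t :: T) by rewrite /= {1}/spread; move: sT => /= ->; lia.
have h2 : sorted spread [seq t - x%:Z | t <- T].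
  by apply: sorted_spread_shift; apply: path_sorted sT.
apply: le_trans (lerD (IH _ h1) (IH _ h2)) _.
rewrite /= size_map add1n top_bin_rec natrD exprS -mulrDl.
rewrite invfM [2^-1 * _]mulrC mulrA divfK //.
Qed.

(** A single window leaves [top_bin k 1], the central binomial coefficient. *)
Lemma littlewood_offord (a : seq nat) (t : int) (q : nat) :
  (0 < q)%N -> (q ^ 2 <= (count (leq L) a).+1)%N ->
  E (size a) (fun b => (t <= (subset_sum b a)%:Z < t + L%:Z)%R%:R) <= q%:R^-1.
Proof.
move=> q0 qk; have := @littlewood_offord_windows a [:: t] isT.
rewrite top_bin1 => h.
rewrite (eq_mean (G := fun b => (hits L [:: t] (subset_sum b a)%:Z)%:R)); last first.
  by move=> b _; rewrite hits_cons /hits addn0.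
apply: le_trans h _; rewrite ler_pdivrMr ?exprn_gt0 // mulrC ler_pdivlMr ?ltr0n //.
by rewrite mulrC -natrM -natrX ler_nat bin_le_div.
Qed.

End LittlewoodOfford.

(** * Horizontal runs *)

(* The number of weak compositions of [a] into [k] parts; the truncated predecessor gives the right
   value also when [k = 0]. *)
Definition wcomp (k a : nat) : nat := 'C((a + k).-1, a).

Lemma wcomp0n a : wcomp 0 a = (a == 0)%N.
Proof. by rewrite /wcomp addn0; case: a => // a; rewrite bin_small. Qed.

Lemma wcompn0 k : wcomp k 0 = 1%N.
Proof. by rewrite /wcomp bin0. Qed.

Lemma wcompSS k a : wcomp k.+1 a.+1 = (wcomp k.+1 a + wcomp k a.+1)%N.
Proof. by rewrite /wcomp !addSn !addnS /= binS addnC. Qed.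

Lemma wcomp_ratio k a : (k * wcomp k.+1 a = (a + k) * wcomp k a)%N.
Proof.
case: k => [|k]; first by rewrite wcomp0n mul0n addn0; case: a => [|a]; rewrite ?muln0.
by rewrite /wcomp !addnS /= (mul_bin_down (a + k).+1 a) subSn ?leq_addr // addKn.
Qed.

(** Coefficient of [x^s] in the product of [(1 - x)^-(a+1)] and [(1 - x)^-(b+1)]. The double
    induction uses Pascal's rule, and [hockey] is the case [a = 0]. *)
Lemma wcomp_sum_conv (a b s : nat) :
  (\sum_(k < s.+1) 'C(a + k, a) * 'C(b + (s - k), b) = 'C(a + b + s.+1, s))%N.
Proof.
have hockey s' b' : (\sum_(k < s'.+1) 'C(b' + (s' - k), b') = 'C(b' + s'.+1, s'))%N.
  elim: s' => [|s' IH]; first by rewrite big_ord1 addn0 binn bin0.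
  rewrite big_ord_recl subn0 (eq_bigr (fun k : 'I_s'.+1 => 'C(b' + (s' - k), b'))) //.
  rewrite IH [(b' + s'.+2)%N]addnS binS; congr (_ + _)%N.
  by rewrite -[in RHS]bin_sub ?leq_addl // addnK.
elim: s a b => [|s IHs] a b; first by rewrite big_ord1 !addn0 !binn bin0.
elim: a b => [|a IHa] b.
  by rewrite -hockey; apply: eq_bigr => k _; rewrite bin0 mul1n.
rewrite big_ord_recl addn0 binn -[in X in (X * _)%N](binn a) -[in X in 'C(X, _)](addn0 a).
rewrite (eq_bigr (fun k : 'I_s.+1 => 'C(a.+1 + k, a.+1) * 'C(b + (s - k), b) +
   'C(a + k.+1, a) * 'C(b + (s - k), b))%N); last first.
  by move=> k _; rewrite -mulnDl /= /bump /= add1n addnS binS addSnnS.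
rewrite big_split /= IHs addnCA.
have := IHa b; rewrite big_ord_recl => ->.
by rewrite !addSn !addnS binS addnC.
Qed.

Section Phi.
Variable R : realFieldType.

(* [a] horizontal steps at the [k] slots of sign [+] and as many at the [k'] slots of sign [-], each
   step having probability [1/3]. *)
Definition Phi (N k k' : nat) : R :=
  \sum_(a < N) (wcomp k a)%:R * (wcomp k' a)%:R / 9 ^+ a.

Lemma Phi_ge0 N k k' : 0 <= Phi N k k'.
Proof. by apply: sumr_ge0 => a _; rewrite divr_ge0 ?exprn_ge0 ?mulr_ge0. Qed.

Lemma PhiC N k k' : Phi N k k' = Phi N k' k.
Proof. by apply: eq_bigr => a _; rewrite [X in X / _]mulrC. Qed.

(** The ratio of [wcomp k.+1 a] to [wcomp k a] is [1 + a / k], which decreases in [k]; hence moving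
    a slot from the larger group to the smaller one cannot decrease the product. *)
Lemma wcomp_balance k k' a : (k < k')%N ->
  (wcomp k a * wcomp k' a <= wcomp k.+1 a * wcomp k'.-1 a)%N.
Proof.
case: k' => // k' /=; rewrite ltnS => kk'.
have [->|k0] := posnP k.
  by rewrite wcomp0n; case: a => [|a]; rewrite ?wcompn0 ?mul0n.
have h1 := wcomp_ratio k a; have h2 := wcomp_ratio k' a.
have kk0 : (0 < k * k')%N by rewrite muln_gt0 k0 (leq_trans k0).
rewrite -(leq_pmul2l kk0).
have -> : (k * k' * (wcomp k a * wcomp k'.+1 a) = k * (a + k') * (wcomp k a * wcomp k' a))%N.
  by rewrite mulnACA h2; ring.
have -> : (k * k' * (wcomp k.+1 a * wcomp k' a) = (a + k) * k' * (wcomp k a * wcomp k' a))%N.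
  by rewrite mulnACA h1; ring.
by rewrite leq_mul2r; apply/orP; right; nia.
Qed.

Lemma Phi_balance N k k' : (k < k')%N -> Phi N k k' <= Phi N k.+1 k'.-1.
Proof.
move=> kk'; apply: ler_sum => a _; rewrite ler_pM2r ?invr_gt0 ?exprn_gt0 //.
by rewrite -!natrM ler_nat wcomp_balance.
Qed.

Lemma Phi_mono N s k i : (k <= i)%N -> (2 * i <= s)%N -> Phi N k (s - k) <= Phi N i (s - i).
Proof.
move=> /subnK <-; elim: (i - k)%N => // d IH h.
rewrite addSn (le_trans (IH _)) //; first lia.
have -> : (s - (d + k).+1 = (s - (d + k)).-1)%N by lia.
by apply: Phi_balance; lia.
Qed.

(** Partial sums of the series of [(1 - x)^-k] at [x = 1/3]: Pascal's rule gives
    [S_(k+1) <= S_(k+1) / 3 + S_k]. *)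
Lemma sum_wcomp_le N k : \sum_(a < N) (wcomp k a)%:R / 3 ^+ a <= (3 / 2) ^+ k :> R.
Proof.
elim: k => [|k IH].
  case: N => [|N]; first by rewrite big_ord0.
  rewrite big_ord_recl /= big1 ?wcompn0 ?addr0 ?divr1 // => i _.
  by rewrite wcomp0n mul0r.
have : \sum_(a < N) (wcomp k.+1 a)%:R / 3 ^+ a <=
  3^-1 * \sum_(a < N) (wcomp k.+1 a)%:R / 3 ^+ a + \sum_(a < N) (wcomp k a)%:R / 3 ^+ a :> R.
  case: N {IH} => [|N]; first by rewrite !big_ord0 mulr0 addr0.
  rewrite [leLHS]big_ord_recl [X in _ <= _ + X]big_ord_recl /= !wcompn0 addrCA lerD2l.
  rewrite [X in _ <= _ * X + _]big_ord_recr /= mulrDr mulr_sumr addrAC -big_split /=.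
  rewrite ler_wpDr ?mulr_ge0 ?invr_ge0 ?divr_ge0 ?exprn_ge0 //.
  rewrite le_eqVlt; apply/orP; left; apply/eqP; apply: eq_bigr => i _.
  by rewrite /bump /= add1n wcompSS natrD exprS invfM; ring.
rewrite exprS; lra.
Qed.
End Phi.

Section PhiBounds.
Variable R : realFieldType.

(** By the convolution identity the sum over [k] is at most [wcomp s.+1 (2 * a).+1] for each [a].
    What remains is three times the odd part of the series in [sum_wcomp_le], at most
    [3 * (3/2)^(s+1)]. *)
Lemma Phi_sum_le N s : \sum_(k < s.+1) Phi R N k (s - k) <= 5 * (3 / 2) ^+ s.
Proof.
pose f j : R := (wcomp s.+1 j)%:R / 3 ^+ j.
have f0 j : 0 <= f j by rewrite divr_ge0 ?exprn_ge0.
apply: (@le_trans _ _ (\sum_(a < N) 3 * f (2 * a).+1)).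
  rewrite exchange_big /=; apply: ler_sum => a _; rewrite -mulr_suml.
  rewrite ler_pdivrMr ?exprn_gt0 //.
  have -> : 3 * f (2 * a).+1 * 9 ^+ a = (wcomp s.+1 (2 * a).+1)%:R.
    by rewrite /f exprS exprM (_ : 3 ^+ 2 = 9) ?expr2 -?natrM //; field; rewrite expf_neq0.
  have -> : wcomp s.+1 (2 * a).+1 = 'C(a + a + s.+1, s).
    by rewrite /wcomp addnS /= -bin_sub ?leq_addr // addKn; congr 'C(_, _); lia.
  rewrite -wcomp_sum_conv natr_sum; apply: ler_sum => k _.
  rewrite -natrM ler_nat; apply: leq_mul; apply: leq_bin2l; exact: leq_pred.
rewrite -mulr_sumr.
have : \sum_(a < N) f (2 * a).+1 <= \sum_(j < 2 * N) f j.
  elim: N => [|N IH]; first by rewrite muln0 !big_ord0.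
  rewrite mulnS !big_ord_recr /= -addrA lerD // lerDr //.
have := sum_wcomp_le R (2 * N) s.+1; rewrite exprS.
have : 0 <= (3 / 2) ^+ s :> R by rewrite exprn_ge0 // divr_ge0.
rewrite /f; lra.
Qed.

(** Both sides count nested pairs of subsets of an [N]-set, the smaller of size [a]. This writes a
    binomial law of parameter [1/3] as a mixture of symmetric ones. *)
Lemma bin_bin_sum N a :
  (\sum_(j < N.+1) 'C(N, j) * 'C(j, a) = 'C(N, a) * 2 ^ (N - a))%N.
Proof.
elim: N a => [|N IH] a; first by rewrite big_ord1 bin0 mul1n sub0n muln1.
have rec b : (\sum_(j < N.+2) 'C(N.+1, j) * 'C(j, b) =
   \sum_(j < N.+1) 'C(N, j) * 'C(j, b) + \sum_(j < N.+1) 'C(N, j) * 'C(j.+1, b))%N.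
  rewrite big_ord_recl /= (eq_bigr (fun i : 'I_N.+1 =>
     'C(N, i.+1) * 'C(i.+1, b) + 'C(N, i) * 'C(i.+1, b))%N); last first.
    by move=> i _; rewrite /bump /= add1n binS mulnDl.
  rewrite big_split /= addnA; congr (_ + _)%N.
  by rewrite big_ord_recr /= (bin_small (ltnSn N)) mul0n addn0 [in RHS]big_ord_recl !bin0.
rewrite rec; case: a => [|a].
  rewrite [X in (_ + X)%N](eq_bigr (fun j : 'I_N.+1 => 'C(N, j) * 'C(j, 0))%N).
    by rewrite IH !bin0 !subn0 expnS; lia.
  by move=> j _; rewrite !bin0.
under [X in (_ + X)%N]eq_bigr do rewrite binS mulnDr.
rewrite big_split /= !IH binS subSS.
have [aN|Na] := ltnP a N; last by rewrite [in 'C(N, a.+1)]bin_small.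
rewrite mulnDl.
have -> : (2 ^ (N - a) = 2 * 2 ^ (N - a.+1))%N by rewrite -expnS subnSK.
lia.
Qed.

(** Up to a power of [3/2], the left side is the probability that a binomial variable of order
    [a + k - 1] and parameter [1/3] equals [a]. As a mixture over [j] of symmetric binomial laws, it
    inherits their bound of order [1 / sqrt (j + 1)]. *)
Lemma wcomp_le (k a q : nat) : (0 < q)%N -> (q ^ 2 <= k)%N ->
  (wcomp k a)%:R / 3 ^+ a <= (3 / 2) ^+ k / q%:R :> R.
Proof.
move=> q0; case: k => [|p] qp; first by move: qp; rewrite leqn0 expn_eq0; case: q q0.
rewrite /wcomp addnS /=; set N := (a + p)%N.
have qR : 0 < q%:R :> R by rewrite ltr0n.
(* The arithmetic-geometric mean inequality turns [1 / sqrt (j + 1)] into a term in [1 / (j + 1)],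
   which absorption removes through [C(N, j) / (j + 1) = C(N + 1, j + 1) / (N + 1)], and a constant
   term. *)
have binR j : ('C(j, a))%:R <= 2 ^+ j * ((q%:R / j.+1%:R + q%:R^-1) / 2) :> R.
  have X0 : 0 < 2 ^+ j :> R by rewrite exprn_gt0.
  rewrite -ler_pdivrMl //; set x := _ * _.
  have xj : x ^+ 2 <= j.+1%:R^-1.
    rewrite /x exprMn exprVn -exprM mulnC exprM ler_pdivrMl ?exprn_gt0 //.
    rewrite ler_pdivlMr ?ltr0n // -!natrX -natrM ler_nat.
    by apply: leq_trans (bin_sqr_le j a); rewrite leq_mul2l leq_addr orbT.
  have : q%:R * x ^+ 2 <= q%:R / j.+1%:R by rewrite ler_pM2l.
  have : 0 <= q%:R * (x - q%:R^-1) ^+ 2 by rewrite mulr_ge0 ?sqr_ge0 // ltW.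
  have qu : q%:R * q%:R^-1 = 1 :> R by rewrite mulfV ?lt0r_neq0.
  have -> : q%:R * (x - q%:R^-1) ^+ 2 = q%:R * x ^+ 2 - 2 * (q%:R * q%:R^-1) * x
    + (q%:R * q%:R^-1) * q%:R^-1 by ring.
  rewrite qu; clearbody x; move: (q%:R / j.+1%:R) => v; move: (q%:R^-1) => u.
  move: (q%:R * x ^+ 2) => w; lra.
(* [5/4 = 3/4 + 1/2], one share for each summand of [binR]. *)
have key : ('C(N, a) * 2 ^ p)%N%:R <= 3 ^+ N * (5 / 4) / q%:R :> R.
  have -> : p = (N - a)%N by rewrite addKn.
  rewrite -bin_bin_sum natr_sum.
  apply: (@le_trans _ _ (\sum_(j < N.+1) (q%:R / 2 / N.+1%:R * ('C(N.+1, j.+1) * 2 ^ j)%:R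
     + (2 * q%:R)^-1 * ('C(N, j) * 2 ^ j)%:R))).
    apply: ler_sum => j _; rewrite natrM.
    apply: le_trans (ler_wpM2l (ler0n _ _) (binR j)) _.
    rewrite le_eqVlt; apply/orP; left; apply/eqP.
    have h : N.+1%:R * ('C(N, j))%:R = j.+1%:R * ('C(N.+1, j.+1))%:R :> R.
      by rewrite -!natrM (mul_bin_diag N.+1).
    have hN : N.+1%:R != 0 :> R by rewrite pnatr_eq0.
    have hj : j.+1%:R != 0 :> R by rewrite pnatr_eq0.
    have hq : q%:R != 0 :> R by rewrite lt0r_neq0.
    rewrite !natrM natrX; move: ('C(N, j))%:R ('C(N.+1, j.+1))%:R (2 ^+ j) h hN hj => c c' X.
    move: N.+1%:R j.+1%:R => u v h hN hj.
    have -> : c = v * c' / u by rewrite -h mulrAC mulfV ?mul1r.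
    by field; rewrite hN hq hj.
  rewrite big_split /= -!mulr_sumr -!natr_sum.
  have h1 : (\sum_(j < N.+1) 'C(N, j) * 2 ^ j = 3 ^ N)%N.
    by rewrite (expnDn 1 2); apply: eq_bigr => j _; rewrite exp1n mul1n.
  have h2 : (2 * (\sum_(j < N.+1) 'C(N.+1, j.+1) * 2 ^ j) <= 3 ^ N.+1)%N.
    rewrite [leqRHS](expnDn 1 2) [leqRHS]big_ord_recl big_distrr /=.
    apply: leq_trans (leq_addl _ _); apply: leq_sum => j _.
    by rewrite exp1n mul1n /bump /= add1n expnS mulnCA.
  rewrite h1; have {}h2 : (\sum_(j < N.+1) 'C(N.+1, j.+1) * 2 ^ j)%:R <= 3 / 2 * 3 ^+ N :> R.
    move: h2; rewrite -(ler_nat R) natrM natrX exprS; lra.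
  have h3 : q%:R / 2 / N.+1%:R <= (2 * q%:R)^-1 :> R.
    rewrite invfM mulrAC [leRHS]mulrC ler_pM2r ?invr_gt0 //.
    rewrite ler_pdivrMr ?ltr0n // mulrC ler_pdivlMr // -natrM ler_nat.
    by move: qp; rewrite /N expnS expn1; lia.
  have h4 : 0 <= q%:R / 2 / N.+1%:R :> R by rewrite !divr_ge0.
  apply: le_trans (lerD (ler_pM h4 (ler0n _ _) h3 h2) (lexx _)) _.
  rewrite le_eqVlt; apply/orP; left; apply/eqP.
  by rewrite natrX; field; rewrite lt0r_neq0.
rewrite natrM natrX in key.
have e3 : 0 < 3 ^+ a :> R by rewrite exprn_gt0.
have p2 : 0 < 2 ^+ p :> R by rewrite exprn_gt0.
have p3 : 0 < 3 ^+ p :> R by rewrite exprn_gt0.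
rewrite ler_pdivrMr // -(ler_pM2r p2); apply: le_trans key _.
rewrite exprMn exprVn !exprS exprD mulrA ler_pdivrMr //.
rewrite -subr_ge0 (_ : _ - _ = 3 ^+ a * 3 ^+ p * (1 / 4)); last first.
  by field; rewrite !lt0r_neq0.
by rewrite !mulr_ge0 ?divr_ge0 // ltW.
Qed.

(** The factor of [k'] is bounded by its maximum, the factor of [k] is summed. *)
Lemma Phi_le N (k k' q : nat) : (0 < q)%N -> (q ^ 2 <= k')%N ->
  Phi R N k k' <= (3 / 2) ^+ (k + k') / q%:R :> R.
Proof.
move=> q0 qk; apply: (@le_trans _ _ (\sum_(a < N) (wcomp k a)%:R / 3 ^+ a *
   ((3 / 2) ^+ k' / q%:R))).
  apply: ler_sum => a _.
  have -> : (wcomp k a)%:R * (wcomp k' a)%:R / 9 ^+ a =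
     (wcomp k a)%:R / 3 ^+ a * ((wcomp k' a)%:R / 3 ^+ a) :> R.
    by rewrite (_ : 9 = 3 * 3) ?exprMn -?natrM //; field; rewrite expf_neq0.
  by rewrite ler_wpM2l ?divr_ge0 ?exprn_ge0 // wcomp_le.
rewrite -mulr_suml exprD mulrA ler_pM2r ?invr_gt0 ?ltr0n // ler_wpM2r ?exprn_ge0 ?divr_ge0 //.
exact: sum_wcomp_le.
Qed.

End PhiBounds.

(** * Averaging a unimodal function over a spread-out argument *)

Section Smoothing.
Variable R : realFieldType.

Lemma sum_window (n k L : nat) : (k + L <= n)%N ->
  \sum_(i < n) ((k <= i < k + L)%N)%:R = L%:R :> R.
Proof.
elim: L => [|L IH] h.
  by rewrite big1 // => i _; rewrite addn0; case: leqP => //= ?; rewrite ltnNge.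
have hk : (k + L < n)%N by rewrite -addnS.
rewrite (eq_bigr (fun i : 'I_n => ((k <= i < k + L)%N)%:R + (i == Ordinal hk)%:R)).
  rewrite big_split /= IH; last by lia.
  rewrite (bigD1 (Ordinal hk)) //= eqxx big1 ?addr0 -1?[L.+1%:R]natr1 // => i.
  by move/negbTE => ->.
move=> i _; rewrite -natrD; congr (_%:R); rewrite -val_eqE /=.
by case: eqP; lia.
Qed.

Variables (f : nat -> R) (s L : nat) (M : R).
Hypothesis L0 : (0 < L)%N.
Hypothesis f0 : forall k, 0 <= f k.
Hypothesis fM : forall k, (k <= s)%N -> f k <= M.
Hypothesis f_incr : forall k i, (k <= i)%N -> (2 * i <= s)%N -> f k <= f i.
Hypothesis f_decr : forall k i, (i <= k <= s)%N -> (s <= 2 * i)%N -> f k <= f i.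

(** The windows starting at [t0] and [t0 + L] cover the indices near the mode, where a range of [L]
    indices towards the mode could cross it. *)
Let t0 : int := (s./2).+1%:Z - L%:Z.
Let win (t : int) (k : nat) : R := (t <= k%:Z < t + L%:Z)%R%:R.

(* Away from the mode, [f k] is at most its average over the [L] indices next to [k] on the side of
   the mode. *)
Lemma unimodal_le_windows (k : nat) : (k <= s)%N ->
  f k <= L%:R^-1 * \sum_(i < s.+1) f i * (win i%:Z k + win (i.+1%:Z - L%:Z) k)
    + M * (win t0 k + win (t0 + L%:Z) k).
Proof.
move=> ks; have win0 t j : 0 <= win t j by rewrite /win ler0n.
have M0 : 0 <= M by apply: le_trans (fM ks).
have LR : 0 < L%:R :> R by rewrite ltr0n.
have Mw : 0 <= M * (win t0 k + win (t0 + L%:Z) k) by rewrite mulr_ge0 ?addr_ge0.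
have S0 : 0 <= L%:R^-1 * \sum_(i < s.+1) f i * (win i%:Z k + win (i.+1%:Z - L%:Z) k).
  rewrite mulr_ge0 ?invr_ge0 ?ler0n //; apply: sumr_ge0 => i _.
  by rewrite mulr_ge0 ?addr_ge0.
(* The indices from [k] to [k + L - 1] all lie left of the mode, so [f k <= f i] there, and the
   window ending at [i] contains [k]. The next case is the mirror image. *)
have [hA|hA] := leqP (2 * (k + L)) (s + 2).
  rewrite ler_wpDr // ler_pdivlMl // mulrC -(@sum_window s.+1 k L); last by lia.
  rewrite mulr_sumr; apply: ler_sum => i _.
  case: (boolP (k <= i < k + L)%N) => [h|_] /=; last by rewrite mulr0 mulr_ge0 ?addr_ge0.
  have -> : win (i.+1%:Z - L%:Z) k = 1 by rewrite /win (_ : (_ <= _ < _)%R = true) //; lia.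
  rewrite mulr1 (le_trans (f_incr _ _ : _ <= f i)) ?ler_peMr ?lerDr //; lia.
have [hB|hB] := leqP (s + 2 * L) (2 * k + 2).
  rewrite ler_wpDr // ler_pdivlMl // mulrC -(@sum_window s.+1 (k.+1 - L) L); last by lia.
  rewrite mulr_sumr; apply: ler_sum => i _.
  case: (boolP (k.+1 - L <= i < _)%N) => [h|_] /=; last by rewrite mulr0 mulr_ge0 ?addr_ge0.
  have -> : win i%:Z k = 1 by rewrite /win (_ : (_ <= _ < _)%R = true) //; lia.
  rewrite mulr1 (le_trans (f_decr _ _ : _ <= f i)) ?ler_peMr ?lerDl //; lia.
rewrite ler_wpDl // (le_trans (fM ks)) // ler_peMr //.
have hs := odd_double_half s.
have [h|h] := ltrP k%:Z (t0 + L%:Z).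
  have -> : win t0 k = 1.
    by rewrite /win (_ : (_ <= _ < _)%R = true) //; move: h; rewrite /t0; lia.
  by rewrite lerDl.
have -> : win (t0 + L%:Z) k = 1.
  by rewrite /win (_ : (_ <= _ < _)%R = true) //; move: h; rewrite /t0; lia.
by rewrite lerDr.
Qed.

(** Every window is hit with probability at most [1 / q]; the factor 2 comes from the two windows
    per index and the two at the mode. *)
Lemma mean_unimodal_le (a : seq nat) (q : nat) :
  sumn a = s -> (0 < q)%N -> (q ^ 2 <= (count (leq L) a).+1)%N ->
  mean [:: true; false] (size a) (fun b => f (subset_sum b a)) <=
  2 / q%:R * (L%:R^-1 * \sum_(i < s.+1) f i + M).
Proof.
move=> sa q0 qL.
have sub_le b : (subset_sum b a <= s)%N by rewrite -sa subset_sum_le.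
have M0 : 0 <= M by apply: le_trans (fM (leq0n _)).
have LO t : mean [:: true; false] (size a) (fun b => win t (subset_sum b a)) <= q%:R^-1 by apply: littlewood_offord.
apply: (@le_trans _ _ (mean [:: true; false] (size a) (fun b => L%:R^-1 * \sum_(i < s.+1)
  f i * (win i%:Z (subset_sum b a) + win (i.+1%:Z - L%:Z) (subset_sum b a))
    + M * (win t0 (subset_sum b a) + win (t0 + L%:Z) (subset_sum b a))))).
  by apply: le_mean => // b _; apply: unimodal_le_windows.
rewrite meanD !meanZ mean_sum meanD.
apply: (@le_trans _ _ (L%:R^-1 * \sum_(i < s.+1) f i * (q%:R^-1 + q%:R^-1) +
   M * (q%:R^-1 + q%:R^-1))).
  apply: lerD; last by rewrite ler_wpM2l // lerD // LO.
  rewrite ler_wpM2l ?invr_ge0 ?ler0n //; apply: ler_sum => i _.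
  by rewrite meanZ meanD ler_wpM2l // lerD // LO.
by rewrite -mulr_suml le_eqVlt; apply/orP; left; apply/eqP; ring.
Qed.

End Smoothing.

(** * Bridges with many heavy sites *)

Section Occupation.
Variable R : realFieldType.

Lemma sum_occ (W : seq int) (p : seq int) (g : int -> R) :
  uniq W -> {subset p <= W} ->
  \sum_(y <- W) (count_mem y p)%:R * g y = \sum_(x <- p) g x.
Proof.
move=> uW; elim: p => [|x p IH] pW.
  by rewrite big_nil big1 // => y _; rewrite mul0r.
have xW : x \in W by rewrite pW ?mem_head.
rewrite big_cons -IH; last by move=> y yp; rewrite pW // inE yp orbT.
rewrite -[g x](_ : \sum_(y <- W) (x == y)%:R * g y = _).
  by rewrite -big_split; apply: eq_bigr => y _; rewrite /= natrD mulrDl.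
rewrite (bigD1_seq x) //= eqxx mul1r big1 ?addr0 // => y; rewrite eq_sym => /negbTE ->.
by rewrite mul0r.
Qed.

Lemma count_ball_le (W : seq int) (z : int) (D : nat) :
  uniq W -> (count (fun y => (`|y - z| <= D)%N) W <= 2 * D + 1)%N.
Proof.
move=> uW; rewrite -size_filter.
pose B := [seq z - D%:Z + i%:Z | i <- iota 0 (2 * D + 1)].
rewrite -[X in (_ <= X)%N](_ : size B = _); last by rewrite size_map size_iota.
apply: uniq_leq_size; first exact: filter_uniq.
move=> y; rewrite mem_filter => /andP[yz _].
apply/mapP; exists (absz (y - z + D%:Z)); first by rewrite mem_iota; lia.
lia.
Qed.

(* Sites visited less than [r^5] times account for at most [3 r^12] visits within distance [r^7] of
   [z]; the second moment bounds the visits farther away, and the energy bounds how many visits a few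
   heavy sites can absorb. *)
Lemma many_heavy_sites (W p : seq int) (z : int) (r : nat) :
  uniq W -> {subset p <= W} -> (0 < r)%N -> (12 * r ^ 12 <= size p)%N ->
  \sum_(y <- W) (count_mem y p)%:R ^+ 2 <= r%:R ^+ 20 :> R ->
  \sum_(x <- p) (x - z)%:~R ^+ 2 <= 3 * r%:R ^+ 26 :> R ->
  (r ^ 4 <= count (leq (r ^ 5)) [seq count_mem y p | y <- W])%N.
Proof.
move=> uW pW r0 hp hE hS; rewrite leqNgt; apply/negP => hk.
have rR : 0 < r%:R :> R by rewrite ltr0n.
have r1 : 1 <= r%:R :> R by rewrite ler1n.
set k := count _ _ in hk.
(* Site by site: a heavy site is paid by [o <= o^2 / (2 r^8) + r^8 / 2], a light one near [z] by
   [o < r^5], a light one far away by [(y - z)^2 > r^14]. The four totals add up to at most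
   [7 r^12]. *)
have : (size p)%:R <= (2 * r%:R ^+ 8)^-1 * \sum_(y <- W) (count_mem y p)%:R ^+ 2 +
    r%:R ^+ 8 / 2 * k%:R +
    r%:R ^+ 5 * (count (fun y => (`|y - z| <= r ^ 7)%N) W)%:R +
    r%:R ^- 14 * \sum_(x <- p) (x - z)%:~R ^+ 2 :> R.
  have -> : (size p)%:R = \sum_(y <- W) (count_mem y p)%:R * 1 :> R.
    by rewrite (sum_occ (fun=> 1) uW pW) big_const_seq count_predT iter_addr addr0.
  rewrite -(sum_occ (fun x => (x - z)%:~R ^+ 2) uW pW) /k count_map.
  rewrite -!sum1_count !natr_sum !mulr_sumr.
  rewrite [\sum_(j <- W | preim _ _ _) _]big_mkcond [\sum_(j <- W | (_ <= _)%N) _]big_mkcond.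
  rewrite -!big_split; apply: ler_sum => y _ /=.
  rewrite mulr1; set o := count_mem y p.
  have T1 : 0 <= (2 * r%:R ^+ 8)^-1 * o%:R ^+ 2 :> R.
    by rewrite mulr_ge0 ?invr_ge0 ?mulr_ge0 ?exprn_ge0 // ltW.
  have T4 : 0 <= r%:R ^- 14 * (o%:R * (y - z)%:~R ^+ 2) :> R.
    by apply: mulr_ge0; [rewrite invr_ge0 exprn_ge0 | rewrite mulr_ge0 ?sqr_ge0].
  have T3 : 0 <= (if (`|y - z| <= r ^ 7)%N then r%:R ^+ 5 * 1 else 0) :> R.
    by case: ifP => // _; rewrite mulr1 exprn_ge0 // ltW.
  case: (leqP (r ^ 5) o) => [big|small].
    apply: (@le_trans _ _ ((2 * r%:R ^+ 8)^-1 * o%:R ^+ 2 + r%:R ^+ 8 / 2 * 1)); last first.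
      by rewrite -!addrA lerD2l lerDl addr_ge0.
    have R8 : 0 < r%:R ^+ 8 :> R by rewrite exprn_gt0.
    rewrite -subr_ge0 (_ : _ - _ = (2 * r%:R ^+ 8)^-1 * (o%:R - r%:R ^+ 8) ^+ 2).
      by rewrite mulr_ge0 ?sqr_ge0 ?invr_ge0 ?mulr_ge0 // ltW.
    by field; rewrite lt0r_neq0.
  case: ifP T3 => [_ _|/negbT far _].
    rewrite addr0 mulr1 -addrA; apply: ler_wpDl => //; apply: ler_wpDr => //.
    by rewrite -natrX ler_nat ltnW.
  rewrite !addr0; apply: ler_wpDl => //.
  rewrite mulrCA ler_peMr // ler_pdivlMl ?exprn_gt0 // mulr1.
  rewrite -ltnNge in far.
  rewrite -(real_normK (num_real (y - z)%:~R)) -intr_norm -natr_absz -!natrX ler_nat.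
  by rewrite (expnM r 7 2) leq_sqr ltnW.
move: hp; rewrite -(ler_nat R) natrM natrX => hp /(le_trans hp).
have hB := count_ball_le z (r ^ 7) uW.
have {}hB : (count (fun y => (`|y - z| <= r ^ 7)%N) W)%:R <= 3 * r%:R ^+ 7 :> R.
  by rewrite -natrX -natrM ler_nat; apply: leq_trans hB _; have : (0 < r ^ 7)%N; rewrite ?expn_gt0 ?r0 //; lia.
have {}hk : k%:R <= r%:R ^+ 4 :> R by rewrite -natrX ler_nat ltnW.
have p8 : 0 < r%:R ^+ 8 :> R by rewrite exprn_gt0.
have p12 : 0 < r%:R ^+ 12 :> R by rewrite exprn_gt0.
have p14 : 0 < r%:R ^+ 14 :> R by rewrite exprn_gt0.
have a1 : (2 * r%:R ^+ 8)^-1 * \sum_(y <- W) (count_mem y p)%:R ^+ 2 <= r%:R ^+ 12 / 2 :> R.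
  rewrite ler_pdivrMl ?mulr_gt0 // (le_trans hE) // le_eqVlt; apply/orP; left.
  by apply/eqP; field.
have a2 : r%:R ^+ 8 / 2 * k%:R <= r%:R ^+ 12 / 2 :> R.
  have -> : r%:R ^+ 12 / 2 = r%:R ^+ 8 / 2 * r%:R ^+ 4 :> R by field.
  by rewrite ler_wpM2l // divr_ge0 // ltW.
have a3 : r%:R ^+ 5 * (count (fun y => (`|y - z| <= r ^ 7)%N) W)%:R <= 3 * r%:R ^+ 12 :> R.
  have -> : 3 * r%:R ^+ 12 = r%:R ^+ 5 * (3 * r%:R ^+ 7) :> R by ring.
  by rewrite ler_wpM2l // exprn_ge0 // ltW.
have a4 : r%:R ^- 14 * \sum_(x <- p) (x - z)%:~R ^+ 2 <= 3 * r%:R ^+ 12 :> R.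
  rewrite ler_pdivrMl // (le_trans hS) // le_eqVlt; apply/orP; left.
  by apply/eqP; ring.
lra.
Qed.

Lemma occ_cat_le z v1 v2 y : (occ z v1 y <= occ z (v1 ++ v2) y)%N.
Proof.
rewrite /occ; elim: v1 z => [|s v1 IH] z /=; last by rewrite leq_add2l.
by case: v2 => //= s v2; rewrite leq_add2l.
Qed.

End Occupation.

(** * Local bound for the height of the simple walk *)

Section HeightLaw.
Variable R : realFieldType.

Lemma mean_map (T U : eqType) (g : T -> U) (A : seq T) n (F : seq U -> R) :
  mean (map g A) n F = mean A n (fun w => F (map g w)).
Proof.
elim: n F => [|n IH] F; first by rewrite !mean0.
by rewrite !meanS size_map big_map; congr (_ / _); apply: eq_bigr => s _; exact: IH.
Qed.

Definition sgnb (b : bool) : int := if b then 1 else -1.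

(** The height is [2 j - m] with [j] a subset sum of unit weights: the Littlewood-Offord inequality
    with windows of length 1. *)
Lemma mean_height_eq_le (m q : nat) (x : int) :
  (0 < q)%N -> (q ^ 2 <= m.+1)%N ->
  mean srw_steps m (fun v => (height v == x)%:R) <= q%:R^-1 :> R.
Proof.
move=> q0 qm; have -> : srw_steps = map sgnb [:: true; false] by [].
rewrite mean_map.
have cnt : count (leq 1) (nseq m 1%N) = m by rewrite count_nseq mul1n.
have := @littlewood_offord R 1 (nseq m 1%N) ((x + m%:Z) %/ 2)%Z q q0.
rewrite cnt => /(_ qm); rewrite size_nseq; apply: le_trans; apply: le_mean => // b.
rewrite mem_words => /andP[/eqP sb _]; rewrite ler_nat.
have hb : height (map sgnb b) = 2 * (subset_sum b (nseq m 1%N))%:Z - m%:Z.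
  rewrite -sb; elim: (b) => [|e b' IH] /=; first by rewrite height_nil.
  by rewrite height_cons IH; case: e => /=; lia.
case: eqP => //= hx; rewrite (_ : (_ <= _ < _)%R = true) // -hx hb.
by rewrite subrK mulrC mulzK //; lia.
Qed.

End HeightLaw.

(** * Environment averages over bridges *)

Section Bridge.
Variable R : realFieldType.
Variables (N : nat) (z : int) (W : seq int).
Hypothesis uW : uniq W.

Definition nplus (b : seq bool) (v : seq int) : nat :=
  subset_sum b [seq occ z v y | y <- W].

Definition phi (v : seq int) (b : seq bool) : R :=
  Phi R N (nplus b v) ((size v).+1 - nplus b v).

(** For [m] of order [r^12] the thresholds are [m^(1/3)] sites and [m^(5/12)] visits; the parameter
    [r] keeps all exponents integral. *)
Definition heavy (r : nat) (v : seq int) : bool :=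
  (r ^ 4 <= count (leq (r ^ 5)) [seq occ z v y | y <- W])%N.

Lemma sumn_occ (v : seq int) : {subset heights z v <= W} ->
  sumn [seq occ z v y | y <- W] = (size v).+1.
Proof.
move=> vW; apply/eqP; rewrite -(eqr_nat R) sumnE big_map natr_sum.
rewrite (eq_bigr (fun y => (count_mem y (heights z v))%:R * 1)) => [|y _]; last by rewrite mulr1.
rewrite (sum_occ (fun=> 1) uW vW) big_const_seq count_predT iter_addr addr0.
by rewrite size_heights.
Qed.

(** At least one of [k] and [s - k] reaches [q ^ 2]. *)
Lemma Phi_max_le (s k q : nat) : (k <= s)%N -> (0 < q)%N -> (2 * q ^ 2 <= s.+1)%N ->
  Phi R N k (s - k) <= (3 / 2) ^+ s / q%:R.
Proof.
move=> ks q0 qs; have [h|h] := leqP (q ^ 2) (s - k).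
  by apply: le_trans (Phi_le R N k q0 h) _; rewrite subnKC.
have h' : (q ^ 2 <= k)%N by lia.
by rewrite PhiC; apply: le_trans (Phi_le R N _ q0 h') _; rewrite subnK.
Qed.

Lemma phi_le (v : seq int) b (q : nat) : {subset heights z v <= W} ->
  (0 < q)%N -> (2 * q ^ 2 <= (size v).+2)%N ->
  phi v b <= (3 / 2) ^+ (size v).+1 / q%:R.
Proof.
by move=> vW q0 qv; apply: Phi_max_le => //; rewrite -(sumn_occ vW) subset_sum_le.
Qed.

(** A heavy word is smoothed with [L = r^5] and window probability [r^-2], which gives [2 / r^2 * (5
    / r^5 + 1 / r^6) <= 12 / r^7]. For other words the maximum [r^-6] is used. *)
Lemma mean_phi_le (r : nat) (v : seq int) : {subset heights z v <= W} ->
  (0 < r)%N -> (2 * r ^ 12 <= size v)%N ->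
  mean [:: true; false] (size W) (phi v) <=
  (3 / 2) ^+ (size v).+1 * (12 / r%:R ^+ 7 + (~~ heavy r v)%:R / r%:R ^+ 6).
Proof.
move=> vW r0 rv; set s := (size v).+1; set X := (3 / 2) ^+ s.
have X0 : 0 < X by rewrite exprn_gt0 // divr_gt0.
have rR : 0 < r%:R :> R by rewrite ltr0n.
have r1 : 1 <= r%:R :> R by rewrite ler1n.
have r6 : (0 < r ^ 6)%N by rewrite expn_gt0 r0.
have qs : (2 * (r ^ 6) ^ 2 <= s.+1)%N by rewrite -expnM; lia.
case: (boolP (heavy r v)) => hv /=; last first.
  apply: mean_leC => // b _; apply: le_trans (phi_le b vW r6 qs) _.
  rewrite natrX -/X ler_pM2l // mul1r lerDr divr_ge0 ?exprn_ge0 // ltW.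
rewrite mul0r addr0.
have -> : size W = size [seq occ z v y | y <- W] by rewrite size_map.
have L0 : (0 < r ^ 5)%N by rewrite expn_gt0 r0.
have q0 : (0 < r ^ 2)%N by rewrite expn_gt0 r0.
have ql : ((r ^ 2) ^ 2 <= (count (leq (r ^ 5)) [seq occ z v y | y <- W]).+1)%N.
  by rewrite -expnM leqW.
have := @mean_unimodal_le R (fun k => Phi R N k (s - k)) s (r ^ 5) (X / (r ^ 6)%:R) L0.
move=> /(_ _ _ _ _ _ _ (sumn_occ vW) q0 ql) H.
apply: (le_trans (H _ _ _ _)).
- by move=> k; apply: Phi_ge0.
- by move=> k ks; apply: Phi_max_le.
- by move=> k i; apply: Phi_mono.
- move=> k i /andP[ik ks] si; rewrite PhiC [leRHS]PhiC.
  have := @Phi_mono R N s (s - k) (s - i).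
  by rewrite !subKn ?(leq_trans ik) //; apply; lia.
have S5 := Phi_sum_le R N s.
have {}S5 : (r ^ 5)%:R^-1 * \sum_(k < s.+1) Phi R N k (s - k) <= (r ^ 5)%:R^-1 * (5 * X).
  by rewrite ler_wpM2l ?invr_ge0.
apply: (@le_trans _ _ (2 / (r ^ 2)%:R * ((r ^ 5)%:R^-1 * (5 * X) + X / (r ^ 6)%:R))).
  by rewrite ler_wpM2l ?divr_ge0 // lerD2r.
rewrite !natrX -subr_ge0.
rewrite (_ : _ - _ = 2 * X / r%:R ^+ 8 * (r%:R - 1)); last by field; rewrite lt0r_neq0.
by rewrite mulr_ge0 ?subr_ge0 // divr_ge0 ?exprn_ge0 ?mulr_ge0 // ltW.
Qed.

(** Markov's inequality in pointwise form: a word that is not heavy violates a moment condition of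
    [many_heavy_sites], which makes one of the two summands exceed 1. *)
Lemma not_heavy_le (r : nat) (v : seq int) : {subset heights z v <= W} ->
  (0 < r)%N -> size v = (12 * r ^ 12)%N ->
  (~~ heavy r v)%:R <= (r%:R ^+ 20)^-1 * (\sum_(y <- W) (occ z v y)%:R ^+ 2) +
    (3 * r%:R ^+ 26)^-1 * (\sum_(x <- heights z v) (x - z)%:~R ^+ 2) :> R.
Proof.
move=> vW r0 sv; have rR : 0 < r%:R :> R by rewrite ltr0n.
set S1 := \sum_(y <- W) _; set S2 := \sum_(x <- _) _.
have S10 : 0 <= S1 by apply: sumr_ge0 => y _; rewrite exprn_ge0.
have S20 : 0 <= S2 by apply: sumr_ge0 => y _; rewrite sqr_ge0.
have r20 : 0 < r%:R ^+ 20 :> R by rewrite exprn_gt0.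
have r26 : 0 < 3 * r%:R ^+ 26 :> R by rewrite mulr_gt0 // exprn_gt0.
have T1 : 0 <= (r%:R ^+ 20)^-1 * S1 by rewrite mulr_ge0 ?invr_ge0 // ltW.
have T2 : 0 <= (3 * r%:R ^+ 26)^-1 * S2 by rewrite mulr_ge0 ?invr_ge0 // ltW.
case: (boolP (heavy r v)) => hv /=; first by rewrite addr_ge0.
have [h1|h1] := lerP S1 (r%:R ^+ 20); last first.
  by rewrite ler_wpDr // ler_pdivlMl // mulr1 ltW.
have [h2|h2] := lerP S2 (3 * r%:R ^+ 26); last first.
  by rewrite ler_wpDl // ler_pdivlMl // mulr1 ltW.
case/negP: hv; apply: many_heavy_sites h2 => //.
by rewrite size_heights sv.
Qed.

(* Heaviness is decided by the first half of a bridge, so that the second half is still free to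
   contribute the probability of closing it. *)
Lemma heavy_cat r v1 v2 : heavy r v1 -> heavy r (v1 ++ v2).
Proof.
move=> h; apply: leq_trans h _; rewrite !count_map; apply: sub_count => y /= h.
exact: leq_trans h (occ_cat_le _ _ _ _).
Qed.

Lemma heights_cat v1 v2 : {subset heights z v1 <= heights z (v1 ++ v2)}.
Proof.
elim: v1 (z) => [|s v1 IH] z' x /=.
  by rewrite inE => /eqP ->; case: v2 => [|? ?]; rewrite mem_head.
by rewrite !inE => /orP[->//|/IH ->]; rewrite orbT.
Qed.

(** Closing the bridge costs [r^-6]. Heavy words add [r^-7]; for the others the maximum of [Phi]
    gives [r^-6] and their rarity [r^-2]. The exponent 13 exceeds the 12 of [m], hence
    summability. *)
Lemma bridge_term_le (m r : nat) :
  (forall v, v \in words srw_steps m -> {subset heights z v <= W}) ->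
  (0 < r)%N -> (24 * r ^ 12 <= m)%N ->
  mean srw_steps m (fun v => (height v == 0)%:R *
    mean [:: true; false] (size W) (phi v)) <=
  441 * (3 / 2) ^+ m.+1 / r%:R ^+ 13.
Proof.
move=> mW r0 rm; set X := (3 / 2) ^+ m.+1.
have X0 : 0 < X by rewrite exprn_gt0 // divr_gt0.
have rR : 0 < r%:R :> R by rewrite ltr0n.
have r1 : 1 <= r%:R :> R by rewrite ler1n.
have r6 : (0 < r ^ 6)%N by rewrite expn_gt0 r0.
have r12 : (0 < r ^ 12)%N by rewrite expn_gt0 r0.
pose l := (12 * r ^ 12)%N.
have lm : m = (l + (m - l))%N by rewrite subnKC //; rewrite /l; lia.
pose B v : R := (r%:R ^+ 20)^-1 * (\sum_(y <- W) (occ z v y)%:R ^+ 2) +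
    (3 * r%:R ^+ 26)^-1 * (\sum_(x <- heights z v) (x - z)%:~R ^+ 2).
have B0 v : 0 <= B v.
  by rewrite addr_ge0 // mulr_ge0 ?invr_ge0 ?mulr_ge0 ?exprn_ge0 ?(ltW rR) //;
    apply: sumr_ge0 => y _; rewrite ?sqr_ge0.
have P0 n q x : (q ^ 2 <= n.+1)%N -> (0 < q)%N ->
    mean srw_steps n (fun v => (height v == x)%:R) <= q%:R^-1 :> R.
  by move=> qn q0; apply: mean_height_eq_le.
have step1 : mean srw_steps m (fun v => (height v == 0)%:R *
    mean [:: true; false] (size W) (phi v)) <=
  X * (12 / r%:R ^+ 7 * mean srw_steps m (fun v => (height v == 0)%:R) +
    (r%:R ^+ 6)^-1 * mean srw_steps m (fun v => (height v == 0)%:R * (~~ heavy r v)%:R)).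
  rewrite -!meanZ -meanD -meanZ; apply: le_mean => // v vm.
  have vW := mW v vm; move: vm; rewrite mem_words => /andP[/eqP sv _].
  have h : (2 * r ^ 12 <= size v)%N by rewrite sv; lia.
  apply: le_trans (ler_wpM2l (ler0n _ _) (mean_phi_le vW r0 h)) _.
  by rewrite sv -/X le_eqVlt; apply/orP; left; apply/eqP; ring.
have step2 : mean srw_steps m (fun v => (height v == 0)%:R * (~~ heavy r v)%:R) <=
   (r%:R ^+ 6)^-1 * mean srw_steps l B.
  rewrite {1}lm mean_cat -meanZ; apply: le_mean => // v1 v1l.
  have v1W v2 : v2 \in words srw_steps (m - l) -> {subset heights z v1 <= W}.
    move=> v2l x xv; apply: (mW (v1 ++ v2)); last exact: heights_cat.
    move: v1l v2l; rewrite !mem_words => /andP[/eqP s1 a1] /andP[/eqP s2 a2].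
    by rewrite size_cat s1 s2 -lm eqxx all_cat a1 a2.
  apply: (@le_trans _ _ (mean srw_steps (m - l)
     (fun v2 => (height v2 == - height v1)%:R * B v1))).
    apply: le_mean => // v2 v2l.
    rewrite height_cat addrC addr_eq0 ler_wpM2l //.
    have v1W' := v1W _ v2l.
    move: v1l; rewrite mem_words => /andP[/eqP s1 _].
    apply: le_trans (not_heavy_le v1W' r0 s1); rewrite ler_nat.
    by case: (boolP (heavy r v1)) => [/heavy_cat -> |_] //; rewrite leq_b1.
  rewrite meanZr ler_wpM2r // -natrX; apply: P0 => //.
  by rewrite -expnM /l; lia.
(* [429 = 13 * 29 + 13 * 12 / 3], from the energy and from the spread. *)
have step3 : mean srw_steps l B <= 429 / r%:R ^+ 2.
  have st : srw_steps = srw_steps \/ srw_steps = lazy_steps by left.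
  rewrite meanD !meanZ.
  have r6R : 0 < r%:R ^+ 6 :> R by rewrite exprn_gt0.
  have E1 := mean_energy_le st z uW r6R (leqnn l).
  have E2 := mean_spread_le R st l z z.
  have hl1 : l.+1%:R <= 13 * r%:R ^+ 12 :> R by rewrite -natrX -natrM ler_nat /l; lia.
  have hl : l%:R = 12 * r%:R ^+ 12 :> R by rewrite /l natrM natrX.
  have R12 : 0 < r%:R ^+ 12 :> R by rewrite exprn_gt0.
  have F1 : 1 + 2 * (l.+1%:R / r%:R ^+ 6 + r%:R ^+ 6) <= 29 * r%:R ^+ 6 :> R.
    have : l.+1%:R / r%:R ^+ 6 <= 13 * r%:R ^+ 6 :> R.
      by rewrite ler_pdivrMr // -mulrA -exprD.
    have : 1 <= r%:R ^+ 6 :> R by rewrite exprn_ege1.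
    lra.
  have {}E1 := le_trans E1 (ler_pM (ler0n _ _) _ hl1 F1).
  rewrite subrr expr0n add0r /= hl in E2.
  have {}E2 := le_trans E2 (ler_wpM2r (mulr_ge0 (ler0n _ 12) (ltW R12)) hl1).
  apply: le_trans (lerD (ler_wpM2l _ (E1 _)) (ler_wpM2l _ E2)) _.
  - by rewrite invr_ge0 exprn_ge0 // ltW.
  - by rewrite addr_ge0 // mulr_ge0 // addr_ge0 ?divr_ge0 ?exprn_ge0 // ltW.
  - by rewrite invr_ge0 mulr_ge0 // exprn_ge0 // ltW.
  rewrite le_eqVlt; apply/orP; left; apply/eqP; field.
  by rewrite lt0r_neq0.
apply: le_trans step1 _; rewrite [441 * X]mulrC -(mulrA X) ler_pM2l //.
have hP : mean srw_steps m (fun v => (height v == 0)%:R) <= (r%:R ^+ 6)^-1 :> R.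
  by rewrite -natrX; apply: P0 => //; rewrite -expnM; lia.
have i6 : 0 <= (r%:R ^+ 6)^-1 :> R by rewrite invr_ge0 exprn_ge0 // ltW.
apply: (@le_trans _ _ (12 / r%:R ^+ 7 * (r%:R ^+ 6)^-1 +
   (r%:R ^+ 6)^-1 * ((r%:R ^+ 6)^-1 * (429 / r%:R ^+ 2)))).
  apply: lerD; first by rewrite ler_wpM2l // divr_ge0 ?exprn_ge0 // ltW.
  by rewrite ler_wpM2l // (le_trans step2) // ler_wpM2l.
rewrite -subr_ge0.
rewrite (_ : _ - _ = 429 / r%:R ^+ 14 * (r%:R - 1)); last by field; rewrite lt0r_neq0.
by rewrite mulr_ge0 ?subr_ge0 // divr_ge0 ?exprn_ge0 // ltW.
Qed.

End Bridge.

(** * The Green function *)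

Section Interleave.
Variable sigma : int -> bool.

Fixpoint hcount (b : bool) (z : int) (w : seq int) : nat :=
  if w is s :: w' then ((s == 0) && (sigma z == b)) + hcount b (z + s) w' else 0.

Definition xdisp (z : int) (w : seq int) : int :=
  (hcount true z w)%:Z - (hcount false z w)%:Z.

Definition vert (w : seq int) : seq int := [seq s <- w | s != 0].

Definition slots (b : bool) (z : int) (v : seq int) : nat :=
  count (fun y => sigma y == b) (heights z v).

Definition wordcount (n : nat) (z : int) (v : seq int) (a b : nat) : nat :=
  count (fun w => [&& vert w == v, hcount true z w == a & hcount false z w == b])
    (words lazy_steps n).

Lemma slots_size z v : (slots true z v + slots false z v = (size v).+1)%N.
Proof.
rewrite -(size_heights z v) -(count_predC (fun y => sigma y == true) (heights z v)).
by congr addn; apply: eq_count => y /=; case: (sigma y).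
Qed.

Lemma size_vert z w : (size w = size (vert w) + hcount true z w + hcount false z w)%N.
Proof.
elim: w z => //= s w IH z; rewrite (IH (z + s)).
by case: eqP => _ /=; case: (sigma z) => /=; lia.
Qed.

Lemma height_vert w : height (vert w) = height w.
Proof.
elim: w => //= s w IH; rewrite height_cons -IH; case: eqP => [->|_] /=; first by rewrite add0r.
by rewrite height_cons.
Qed.

Lemma wordcountS n z v a b : all (mem srw_steps) v ->
  wordcount n.+1 z v a b =
  ((if v is s :: v' then wordcount n (z + s) v' a b else 0) +
   (if sigma z then if a is a'.+1 then wordcount n z v a' b else 0
    else if b is b'.+1 then wordcount n z v a b' else 0))%N.
Proof.
move=> av; rewrite /wordcount.
have -> : words lazy_steps n.+1 = map (cons 1) (words lazy_steps n) ++
    map (cons (-1)) (words lazy_steps n) ++ map (cons 0) (words lazy_steps n) ++ [::] by [].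
rewrite !count_cat !count_map /= addn0 addnA; congr (_ + _)%N.
  case: v av => [|s v'] /=.
    by move=> _; rewrite !(@eq_count _ _ pred0) ?count_pred0.
  case/andP; rewrite !inE => /orP[] /eqP -> _.
    rewrite [X in (_ + X)%N](@eq_count _ _ pred0); last by move=> w.
    by rewrite count_pred0 addn0; apply: eq_count => w /=; rewrite eqseq_cons eqxx.
  rewrite (@eq_count _ _ pred0); last by move=> w.
  by rewrite count_pred0 add0n; apply: eq_count => w /=; rewrite eqseq_cons eqxx.
case sz: (sigma z) => /=.
  case: a => [|a].
    by rewrite (@eq_count _ _ pred0) ?count_pred0 // => w /=; rewrite sz andbF.
  by apply: eq_count => w /=; rewrite sz addr0.
case: b => [|b].
  by rewrite (@eq_count _ _ pred0) ?count_pred0 // => w /=; rewrite sz !andbF.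
by apply: eq_count => w /=; rewrite sz addr0.
Qed.

(** The [a] horizontal steps of sign [true] form a weak composition over the slots of that sign, and
    so do the [b] others. The first-letter recursion is Pascal's rule for the factor of the sign of
    row [z]. *)
Lemma wordcount_eq n z v a b : all (mem srw_steps) v -> (n = size v + a + b)%N ->
  wordcount n z v a b = (wcomp (slots true z v) a * wcomp (slots false z v) b)%N.
Proof.
elim: n z v a b => [|n IH] z v a b av.
  case: v av => [|s v] // _; case: a => // a0; case: b a0 => // _.
  by rewrite !wcompn0 /wordcount.
move=> hn; rewrite wordcountS //.
have rec : ((if v is s :: v' then wordcount n (z + s) v' a b else 0) =
   (if v is s :: v' then wcomp (slots true (z + s) v') a * wcomp (slots false (z + s) v') b
    else wcomp 0 a * wcomp 0 b))%N.
  case: v av hn => [|s v] /= av hn.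
    by rewrite !wcomp0n; case: (a) hn => // ; case: (b).
  by case/andP: av => _ av; rewrite IH //; move: hn; rewrite !addSn => -[].
rewrite {}rec.
(* [kp] and [km] count the slots left after the first one; for empty [v] there are none, and
   [wcomp 0] forbids further horizontal steps. *)
have [kp [km [hp hm ->]]] : exists kp km,
  [/\ slots true z v = ((sigma z == true) + kp)%N, slots false z v = ((sigma z == false) + km)%N &
   (if v is s :: v' then wcomp (slots true (z + s) v') a * wcomp (slots false (z + s) v') b
    else wcomp 0 a * wcomp 0 b) = (wcomp kp a * wcomp km b)]%N.
  case: (v) => [|s v'] /=; first by exists 0%N, 0%N.
  by exists (slots true (z + s) v'), (slots false (z + s) v').
have [sz|sz] : sigma z = true \/ sigma z = false by case: (sigma z); auto.
  rewrite sz in hp hm *; rewrite /= add1n add0n in hp hm.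
  case: a hn => [|a] hn; first by rewrite hp hm !wcompn0 addn0.
  by rewrite IH ?hp ?hm //; [rewrite wcompSS; ring | lia].
rewrite sz in hp hm *; rewrite /= add1n add0n in hp hm.
case: b hn => [|b] hn; first by rewrite hp hm !wcompn0 addn0.
by rewrite IH ?hp ?hm //; [rewrite wcompSS; ring | lia].
Qed.

Lemma wordcount0 n z v a b : n <> (size v + a + b)%N -> wordcount n z v a b = 0%N.
Proof.
move=> hn; apply/eqP; rewrite -leqn0 leqNgt -has_count; apply/hasPn => w.
rewrite mem_words => /andP[/eqP sw _]; apply/negP => /and3P[/eqP vw /eqP ha /eqP hb].
by apply: hn; rewrite -vw -ha -hb -size_vert.
Qed.

Variable R : realFieldType.

Definition at_origin (z : int) (w : seq int) : bool := (xdisp z w == 0) && (height w == 0).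

Lemma le_sum_mem (I : eqType) (r : seq I) (F : I -> R) (i : I) :
  (forall j, 0 <= F j) -> i \in r -> F i <= \sum_(j <- r) F j.
Proof.
move=> F0; elim: r => // j r IH; rewrite inE big_cons => /orP[/eqP <-|/IH h].
  by rewrite lerDl sumr_ge0.
by rewrite (le_trans h) // lerDr.
Qed.

(** Closed words are grouped by their vertical part [v], of length [m], and the number [a] of
    horizontal steps of either sign. Then [n = m + 2a], and the weight [3^-n] splits into [(2/3)^m],
    [2^-m] and [9^-a]. Truncating every index at [N] gives an inequality. *)
Lemma green_le (N : nat) (z : int) :
  \sum_(n < N) mean lazy_steps n (fun w => (at_origin z w)%:R) <=
  \sum_(m < N) (2 / 3) ^+ m * mean srw_steps m (fun v => (height v == 0)%:R *
     Phi R N (slots true z v) (slots false z v)).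
Proof.
pose G (w v : seq int) (a : nat) : R :=
  [&& vert w == v, hcount true z w == a & hcount false z w == a]%:R.
have G0 w v a : 0 <= G w v a by rewrite ler0n.
(* The indicator of a closed word is dominated by the one term of the inner sums that carries its
   own length, vertical part and horizontal count. *)
apply: (@le_trans _ _ (\sum_(n < N) \sum_(w <- words lazy_steps n) \sum_(m < N)
   \sum_(v <- words srw_steps m) \sum_(a < N) (height v == 0)%:R * G w v a / 3 ^+ n)).
  apply: ler_sum => n _; rewrite /mean mulr_suml big_seq [leRHS]big_seq.
  apply: ler_sum => w; rewrite mem_words => /andP[/eqP sw aw].
  have sv := size_vert z w.
  case: (boolP (at_origin z w)) => [/andP[/eqP hx /eqP hz]|_]; last first.
    rewrite mul0r; apply: sumr_ge0 => m _; apply: sumr_ge0 => v _; apply: sumr_ge0 => a _.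
    by rewrite divr_ge0 ?exprn_ge0 ?mulr_ge0.
  have hm : (size (vert w) < N)%N.
    by apply: leq_ltn_trans (ltn_ord n); rewrite -sw sv -addnA leq_addr.
  have ha : (hcount true z w < N)%N.
    by apply: leq_ltn_trans (ltn_ord n); rewrite -sw sv addnAC leq_addl.
  have vw : vert w \in words srw_steps (Ordinal hm).
    rewrite mem_words eqxx /=; apply/allP => s; rewrite mem_filter => /andP[s0 sw'].
    by have := allP aw _ sw'; rewrite /= !inE (negbTE s0) orbF.
  have hab : hcount false z w = hcount true z w by move: hx; rewrite /xdisp; lia.
  pose T (m : nat) v a := (height v == 0)%:R * G w v a / 3 ^+ n : R.
  have T0 m v a : 0 <= T m v a by rewrite divr_ge0 ?exprn_ge0 ?mulr_ge0.
  apply: (@le_trans _ _ (T (Ordinal hm) (vert w) (Ordinal ha))).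
    by rewrite /T height_vert hz eqxx /G hab !eqxx /= mulr1.
  apply: (@le_trans _ _ (\sum_(a < N) T (Ordinal hm) (vert w) a)).
    by apply: (@le_sum_mem _ _ (fun a : 'I_N => T (Ordinal hm) (vert w) a)) => //;
      rewrite mem_index_enum.
  apply: (@le_trans _ _ (\sum_(v <- words srw_steps (Ordinal hm)) \sum_(a < N) T (Ordinal hm) v a)).
    apply: (@le_sum_mem _ _ (fun v => \sum_(a < N) T (Ordinal hm) v a)) => // v.
    by apply: sumr_ge0.
  apply: (@le_sum_mem _ _ (fun m : 'I_N => \sum_(v <- words srw_steps m) \sum_(a < N) T m v a)) => //.
    by move=> m; apply: sumr_ge0 => v _; apply: sumr_ge0.
  by rewrite mem_index_enum.
under eq_bigr do rewrite exchange_big /=.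
rewrite exchange_big /=; apply: ler_sum => m _.
have -> : (2 / 3) ^+ m * mean srw_steps m (fun v => (height v == 0)%:R *
     Phi R N (slots true z v) (slots false z v)) =
   \sum_(v <- words srw_steps m) (height v == 0)%:R *
     Phi R N (slots true z v) (slots false z v) / 3 ^+ m.
  rewrite /mean -mulr_suml /= exprMn exprVn; field.
  by rewrite !expf_neq0.
under eq_bigr do rewrite exchange_big /=.
rewrite exchange_big /= big_seq [leRHS]big_seq; apply: ler_sum => v.
rewrite mem_words => /andP[/eqP sv av].
under eq_bigr do rewrite exchange_big /=.
rewrite exchange_big /= /Phi mulr_sumr mulr_suml; apply: ler_sum => a _.
have Gc n : \sum_(w <- words lazy_steps n) (height v == 0)%:R * G w v a / 3 ^+ n =
    (height v == 0)%:R * (wordcount n z v a a)%:R / 3 ^+ n.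
  rewrite -mulr_suml -mulr_sumr /G /wordcount -sum1_count natr_sum [in RHS]big_mkcond.
  by congr (_ * _ / _); apply: eq_bigr => w _; case: ifP.
under eq_bigr do rewrite Gc.
(* Only this length is compatible with [v] and [a]; if it is not below [N], the sum over lengths
   vanishes. *)
set n0 := (size v + a + a)%N.
have last_le : (height v == 0)%:R * (wordcount n0 z v a a)%:R / 3 ^+ n0 <=
  (height v == 0)%:R * ((wcomp (slots true z v) a)%:R * (wcomp (slots false z v) a)%:R / 9 ^+ a)
   / 3 ^+ m :> R.
  rewrite wordcount_eq // natrM /n0 sv -addnA addnn -mul2n exprD exprM.
  rewrite (_ : 3 ^+ 2 = 9) ?expr2 -?natrM // le_eqVlt; apply/orP; left; apply/eqP.
  by field; rewrite !expf_neq0.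
have rhs0 : 0 <= (height v == 0)%:R *
  ((wcomp (slots true z v) a)%:R * (wcomp (slots false z v) a)%:R / 9 ^+ a) / 3 ^+ m :> R.
  by rewrite divr_ge0 ?exprn_ge0 ?mulr_ge0 ?invr_ge0 ?exprn_ge0.
have [n0N|Nn0] := ltnP n0 N.
  rewrite (bigD1 (Ordinal n0N)) //= big1 ?addr0 // => n; rewrite -val_eqE /= => /eqP nn0.
  by rewrite wordcount0 // mulr0 mul0r.
rewrite big1 // => n _; rewrite wordcount0 ?mulr0 ?mul0r // => h.
by have := ltn_ord n; rewrite h ltnNge Nn0.
Qed.

End Interleave.

(** * Summing the bridge terms *)

Section Summation.
Variable R : realFieldType.

(** In the binomial expansion every power below the top one is at most [x ^+ k], and their
    coefficients sum to [2 ^+ k.+1 - 1]. *)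
Lemma exprD1_le (x : R) (k : nat) : 1 <= x ->
  (x + 1) ^+ k.+1 <= x ^+ k.+1 + (2 ^+ k.+1 - 1) * x ^+ k.
Proof.
move=> x1; elim: k => [|k IH]; first by rewrite !expr1 expr0; lra.
have x0 : 0 <= x by lra.
rewrite exprSr; apply: le_trans (ler_wpM2r _ IH) _; first by lra.
have h2 : 1 <= 2 ^+ k.+1 :> R by rewrite exprn_ege1 // ler1n.
have xk : 0 <= x ^+ k by rewrite exprn_ge0.
rewrite [x ^+ k.+2]exprS [2 ^+ k.+2]exprS [x ^+ k.+1]exprS.
rewrite -subr_ge0 (_ : _ - _ = (2 ^+ k.+1 - 1) * x ^+ k * (x - 1)); last by ring.
by rewrite !mulr_ge0 //; lra.
Qed.

(** The blocks end at [24 r^12]: a block has of order [r^11] terms of size [r^-13], so its sum is of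
    order [r^-2]. [D] comes before [b] to be uniform in the horizon and the starting height. *)
Lemma dyadic_sum_bounded (B C : R) : 0 <= C ->
  exists D, forall b : nat -> R, (forall m, 0 <= b m <= B) ->
  (forall m r, (0 < r)%N -> (24 * r ^ 12 <= m)%N -> b m <= C / r%:R ^+ 13) ->
  forall M, \sum_(m < M) b m <= D.
Proof.
(* The last factor 2 is that of [1 / r^2 <= 2 * (1 / r - 1 / (r + 1))], which telescopes. *)
move=> C0; pose K := C * 24 * (2 ^+ 12 - 1) * 2.
have c0 : 0 <= 2 ^+ 12 - 1 :> R by rewrite subr_ge0 exprn_ege1 // ler1n.
have K0 : 0 <= K by rewrite !mulr_ge0.
move: (2 ^+ 12 - 1) (@exprD1_le ^~ 11%N) @K K0 c0 => c exprc K K0 c0.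
exists (24 * B + K * 2) => b bB bC.
have claim r : \sum_(m < 24 * r.+1 ^ 12) b m <= 24 * B + K * (2 - r.+1%:R^-1).
  elim: r => [|r IH].
    rewrite exp1n muln1 invr1; apply: (@le_trans _ _ (\sum_(m < 24) B)).
      by apply: ler_sum => m _; case/andP: (bB m).
    by rewrite sumr_const card_ord -[B *+ _]mulr_natl lerDl mulr_ge0 //; lra.
  pose f1 := (24 * r.+1 ^ 12)%N; pose f2 := (24 * r.+2 ^ 12)%N.
  have f12 : (f1 <= f2)%N by rewrite leq_mul2l leq_exp2r // leqnSn.
  rewrite -/f2 -(big_mkord xpredT b) (@big_cat_nat _ _ _ f1) //= big_mkord.
  have x1 : 1 <= r.+1%:R :> R by rewrite ler1n.
  have x0 : 0 < r.+1%:R :> R by rewrite ltr0n.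
  have h : \sum_(f1 <= m < f2) b m <= (f2 - f1)%:R * (C / r.+1%:R ^+ 13).
    apply: (@le_trans _ _ (\sum_(f1 <= m < f2) C / r.+1%:R ^+ 13)).
      rewrite big_nat_cond [leRHS]big_nat_cond; apply: ler_sum => m /andP[/andP[hm _] _].
      exact: bC.
    by rewrite sumr_const_nat -[_ *+ (f2 - f1)]mulr_natl.
  have h' : (f2 - f1)%:R <= 24 * (c * r.+1%:R ^+ 11) :> R.
    rewrite natrB // /f2 /f1 2!(natrM R 24) !natrX -mulrBr ler_pM2l //.
    by have := exprc _ x1; rewrite natr1 lerBlDl.
  apply: le_trans (lerD IH h) _; rewrite -addrA lerD2l.
  have {}h' := ler_wpM2r (divr_ge0 C0 (exprn_ge0 13 (ltW x0))) h'.
  apply: le_trans (lerD (lexx _) h') _.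
  have -> : 24 * (c * r.+1%:R ^+ 11) * (C / r.+1%:R ^+ 13) = K / 2 * r.+1%:R^-1 ^+ 2.
    by rewrite /K; field; rewrite lt0r_neq0.
  rewrite -[r.+2%:R]natr1; move: r.+1%:R x1 x0 => x x1 x0.
  rewrite -subr_ge0 (_ : _ - _ = K / 2 * ((x - 1) / (x ^+ 2 * (x + 1)))); last first.
    by field; rewrite !lt0r_neq0 //; lra.
  by rewrite mulr_ge0 ?divr_ge0 ?mulr_ge0 ?sqr_ge0 //; lra.
move=> M.
apply: (@le_trans _ _ (\sum_(m < 24 * M.+1 ^ 12) b m)).
  have h : (M <= 24 * M.+1 ^ 12)%N.
    apply: (@leq_trans (M.+1 ^ 12)); last by rewrite leq_pmull.
    by apply: leq_trans (leqnSn M) _; rewrite -[X in (X <= _)%N]expn1 leq_pexp2l.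
  rewrite -!(big_mkord xpredT b) (@big_cat_nat _ _ _ M _ (24 * M.+1 ^ 12)) //= lerDl.
  by apply: sumr_ge0 => m _; case/andP: (bB m).
apply: le_trans (claim M) _; rewrite lerD2l ler_wpM2l // gerBl invr_ge0 //.
Qed.

End Summation.

(** * Environments coded by words of signs *)

Definition env (W : seq int) (b : seq bool) (y : int) : bool := nth false b (index y W).

Lemma env_cons y W e b x : x \in W -> uniq (y :: W) -> env (y :: W) (e :: b) x = env W b x.
Proof.
move=> xW /= /andP[yW _]; rewrite /env /=; case: eqP => // yx.
by rewrite yx xW in yW.
Qed.

Definition window (z : int) (N : nat) : seq int :=
  [seq z - N%:Z + i%:Z | i <- iota 0 (2 * N + 1)].

Lemma window_uniq z N : uniq (window z N).
Proof. by rewrite map_inj_uniq ?iota_uniq // => i j /addrI [->]. Qed.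

Lemma mem_window z N (y : int) : (y \in window z N) = (`|y - z| <= N)%N.
Proof.
apply/mapP/idP => [[i]|h]; first by rewrite mem_iota => ? ->; lia.
by exists (absz (y - z + N%:Z)); [rewrite mem_iota|]; lia.
Qed.

Lemma heights_window (w : seq int) (z : int) (N : nat) :
  all (mem lazy_steps) w -> (size w <= N)%N -> {subset heights z w <= window z N}.
Proof.
move=> aw sw y yw; rewrite mem_window; apply: leq_trans sw.
elim: w z aw y yw => [|s w IH] z /=.
  by move=> _ y; rewrite inE => /eqP ->; rewrite subrr.
case/andP => hs aw y; rewrite inE => /orP[/eqP ->|/(IH _ aw)]; first by rewrite subrr.
by move: hs; rewrite !inE => /or3P[] /eqP ->; lia.
Qed.

Lemma srw_lazy (v : seq int) : all (mem srw_steps) v -> all (mem lazy_steps) v.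
Proof. by apply: sub_all => s; rewrite !inE => /orP[] ->; rewrite ?orbT. Qed.

Section Annealed.
Variable R : realFieldType.
Local Notation bb := [:: true; false].

Lemma subset_sum_env (W : seq int) (b : seq bool) (f : int -> nat) :
  uniq W -> size b = size W ->
  (subset_sum b [seq f y | y <- W] = \sum_(y <- W) env W b y * f y)%N.
Proof.
elim: W b => [|y W IH] [|e b] //=; first by rewrite big_nil.
move=> uW [sb]; have /andP[yW uW'] := uW.
rewrite big_cons {1}/env /= eqxx (IH _ uW' sb); congr (_ + _)%N.
by rewrite big_seq [RHS]big_seq; apply: eq_bigr => x xW; rewrite env_cons.
Qed.

Lemma slots_env (W : seq int) (b : seq bool) (z : int) (v : seq int) :
  uniq W -> size b = size W -> {subset heights z v <= W} ->
  slots (env W b) true z v = nplus z W b v.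
Proof.
move=> uW sb vW; rewrite /nplus subset_sum_env //.
apply/eqP; rewrite -(eqr_nat R) natr_sum.
rewrite (eq_bigr (fun y => (count_mem y (heights z v))%:R * (env W b y)%:R)) => [|y _]; last first.
  by rewrite natrM mulrC.
rewrite (sum_occ (fun y => (env W b y)%:R) uW vW) /slots -sum1_count natr_sum big_mkcond.
by apply/eqP; apply: eq_bigr => y _; case: (env W b y).
Qed.

Lemma mean_swap (T U : eqType) (A : seq T) (B : seq U) n k (F : seq T -> seq U -> R) :
  mean A n (fun w => mean B k (F w)) = mean B k (fun u => mean A n (F ^~ u)).
Proof.
by rewrite /mean -!mulr_suml mulrAC exchange_big.
Qed.

Definition return_prob (sigma : int -> bool) (z : int) (n : nat) : R :=
  mean lazy_steps n (fun w => (at_origin sigma z w)%:R).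

(** The powers [(2/3)^m] and [(3/2)^(m+1)] cancel to [3/2], which leaves the terms [r^-13] of the
    bridges and a trivial bound for small [m]. *)
Lemma annealed_green_bounded : exists D : R, forall (N : nat) (z : int),
  mean bb (size (window z N)) (fun b => \sum_(n < N) return_prob (env (window z N) b) z n) <= D.
Proof.
have C0 : 0 <= 441 * (3 / 2) :> R by lra.
have [D HD] := dyadic_sum_bounded (3 / 2) C0.
exists D => N z; set W := window z N.
have uW : uniq W by apply: window_uniq.
have hW m v : (m < N)%N -> v \in words srw_steps m -> {subset heights z v <= W}.
  move=> mN; rewrite mem_words => /andP[/eqP sv av].
  by apply: heights_window; [exact: srw_lazy|rewrite sv ltnW].
pose g m := mean srw_steps m (fun v => (height v == 0)%:R * mean bb (size W) (@phi R N z W v)).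
(* The window contains the trajectories of words shorter than [N] only; the cut-off lets the
   summation lemma apply to all [m]. *)
pose t m : R := if (m < N)%N then (2 / 3) ^+ m * g m else 0.
have c0 m : 0 <= (2 / 3) ^+ m :> R by rewrite exprn_ge0 // divr_ge0.
have c1 m : (2 / 3) ^+ m * (3 / 2) ^+ m.+1 = 3 / 2 :> R.
  by rewrite exprS mulrCA -exprMn (_ : 2 / 3 * (3 / 2) = 1) ?expr1n ?mulr1 //; field.
apply: (@le_trans _ _ (\sum_(m < N) t m)); last first.
  apply: HD => [m|m r r0 rm]; rewrite /t; case: ifP => mN; rewrite ?lexx ?divr_ge0 //.
  - apply/andP; split.
      rewrite mulr_ge0 //; apply: mean_ge0 => v _; rewrite mulr_ge0 //.
      by apply: mean_ge0 => b _; apply: Phi_ge0.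
    rewrite -(c1 m) ler_wpM2l //; apply: mean_leC => // v vm.
    have vW := hW _ _ mN vm; move: vm; rewrite mem_words => /andP[/eqP sv _].
    apply: (@le_trans _ _ (mean bb (size W) (@phi R N z W v))).
      rewrite ler_piMl ?lern1 ?leq_b1 //.
      by apply: mean_ge0 => b _; apply: Phi_ge0.
    apply: mean_leC => // b _; apply: le_trans (phi_le R N uW b vW (ltn0Sn 0) _) _ => //.
    by rewrite sv divr1.
  - rewrite -(c1 m) [441 * _]mulrC -!mulrA ler_wpM2l //.
    apply: le_trans (bridge_term_le R N uW _ r0 rm) _; first by move=> v; apply: hW.
    by rewrite le_eqVlt; apply/orP; left; apply/eqP; ring.
apply: (@le_trans _ _ (mean bb (size W) (fun b => \sum_(m < N) (2 / 3) ^+ m *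
   mean srw_steps m (fun v => (height v == 0)%:R *
     Phi R N (slots (env W b) true z v) (slots (env W b) false z v))))).
  by apply: le_mean => // b _; apply: green_le.
rewrite mean_sum; apply: ler_sum => m _; rewrite /t ltn_ord meanZ ler_wpM2l //.
rewrite mean_swap le_eqVlt; apply/orP; left; apply/eqP; apply: eq_mean => v vm.
rewrite meanZ; congr (_ * _); apply: eq_mean => b; rewrite mem_words => /andP[/eqP sb _].
have vW := hW _ _ (ltn_ord m) vm.
rewrite /phi -(slots_env uW sb vW); congr (Phi R N _ _).
by rewrite -(slots_size (env W b) z v) addKn.
Qed.

(** * Averaged second moment of the displacement *)

Fixpoint signed_sum (b : seq bool) (a : seq nat) : int :=
  match b, a with
  | e :: b', x :: a' => sgnb e * x%:Z + signed_sum b' a'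
  | _, _ => 0
  end.

(** The cross terms cancel between the two signs; the offset [x] serves the induction. *)
Lemma mean_signed_sum_sqr (a : seq nat) (x : R) :
  mean bb (size a) (fun b => (x + (signed_sum b a)%:~R) ^+ 2) =
  x ^+ 2 + \sum_(y <- a) y%:R ^+ 2.
Proof.
elim: a x => [|y a IH] x; first by rewrite mean0 /= big_nil !addr0.
rewrite meanS !big_cons big_nil addr0.
rewrite (eq_mean (G := fun w => (x + y%:R + (signed_sum w a)%:~R) ^+ 2)); last first.
  by move=> w _ /=; rewrite mul1r intrD addrA.
rewrite [X in _ + X](eq_mean (G := fun w => (x - y%:R + (signed_sum w a)%:~R) ^+ 2)); last first.
  by move=> w _ /=; rewrite mulN1r intrD addrA intrN.
by rewrite !IH /=; field.
Qed.

Fixpoint hvisits (z : int) (w : seq int) (y : int) : nat :=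
  if w is s :: w' then ((s == 0) && (z == y)) + hvisits (z + s) w' y else 0.

Lemma hvisits_le z w y : (hvisits z w y <= occ z w y)%N.
Proof.
elim: w z => [|s w IH] z //=; rewrite /occ /= leq_add //.
by case: (s == 0).
Qed.

Lemma xdisp_env (W : seq int) (b : seq bool) (z : int) (w : seq int) :
  uniq W -> size b = size W -> {subset heights z w <= W} ->
  xdisp (env W b) z w = signed_sum b [seq hvisits z w y | y <- W].
Proof.
move=> uW sb wW.
have -> : signed_sum b [seq hvisits z w y | y <- W] =
  \sum_(y <- W) sgnb (env W b y) * (hvisits z w y)%:Z.
  elim: W b uW sb {wW} => [|y W IH] [|e b] //=; first by rewrite big_nil.
  move=> uW [sb]; have /andP[yW uW'] := uW.
  rewrite big_cons {1}/env /= eqxx (IH _ uW' sb); congr (_ + _).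
  by rewrite big_seq [RHS]big_seq; apply: eq_bigr => x xW; rewrite env_cons.
elim: w z wW => [|s w IH] z wW.
  by rewrite /xdisp /= big1 // => y _; rewrite mulr0.
have zW : z \in W by apply: wW; rewrite /= mem_head.
have wW' : {subset heights (z + s) w <= W}.
  by move=> x xw; apply: wW; rewrite /= inE xw orbT.
have {}IH := IH _ wW'; move: IH; rewrite /xdisp /= => IH.
rewrite (eq_bigr (fun y => (if z == y then sgnb (env W b z) * (s == 0)%:Z else 0) +
   sgnb (env W b y) * (hvisits (z + s) w y)%:Z)); last first.
  move=> y _; rewrite PoszD mulrDr; congr (_ + _).
  by case: (s == 0); case: (eqVneq z y) => [->|_]; rewrite /= ?mulr0.
rewrite big_split /= -IH.
rewrite (bigD1_seq z) //= eqxx big1 => [|y]; last by rewrite eq_sym => /negbTE ->.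
by case: (s == 0); case: (env W b z) => /=; lia.
Qed.

(** The average over signs leaves the squares of [hvisits], bounded by the energy. With [c = k^2]
    the energy is at most [2 k^4 * 7 k^2], and the height adds at most [k^6]. *)
Lemma annealed_speed_bound (k : nat) (W : seq int) : (0 < k)%N -> uniq W ->
  (forall w, w \in words lazy_steps (k ^ 4) -> {subset heights 0 w <= W}) ->
  mean bb (size W) (fun b => mean lazy_steps (k ^ 4) (fun w =>
    ((xdisp (env W b) 0 w)%:~R ^+ 2 + (height w)%:~R ^+ 2) / k%:R ^+ 8)) <=
  15 / k%:R ^+ 2 :> R.
Proof.
move=> k0 uW hW; have kR : 0 < k%:R :> R by rewrite ltr0n.
have k1 : 1 <= k%:R :> R by rewrite ler1n.
have st : lazy_steps = srw_steps \/ lazy_steps = lazy_steps by right.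
rewrite mean_swap.
apply: (@le_trans _ _ (mean lazy_steps (k ^ 4) (fun w =>
  (\sum_(y <- W) (occ 0 w y)%:R ^+ 2 + (0 + (height w)%:~R) ^+ 2) / k%:R ^+ 8))).
  apply: le_mean => // w wk; rewrite meanZr ler_wpM2r ?invr_ge0 ?exprn_ge0 //.
  rewrite meanD mean_const // add0r lerD2r.
  rewrite (eq_mean (G := fun b => (0 + (signed_sum b [seq hvisits 0 w y | y <- W])%:~R) ^+ 2)).
    rewrite -[size W](size_map (hvisits 0 w)) mean_signed_sum_sqr expr0n add0r big_map.
    apply: ler_sum => y _; rewrite lerXn2r ?nnegrE // ler_nat; exact: hvisits_le.
  move=> b; rewrite mem_words => /andP[/eqP sb _]; rewrite add0r xdisp_env //.
  exact: hW.
rewrite meanZr meanD (mean_sqr_height st) expr0n add0r.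
have k2 : 0 < k%:R ^+ 2 :> R by rewrite exprn_gt0.
have E1 := mean_energy_le st 0 uW k2 (leqnn (k ^ 4)).
have hk : (k ^ 4).+1%:R <= 2 * k%:R ^+ 4 :> R.
  rewrite -natrX -natrM ler_nat mul2n -addnn -addn1 leq_add2l expn_gt0 k0 //.
have h2 : 1 <= k%:R ^+ 2 :> R by rewrite exprn_ege1.
have F1 : 1 + 2 * ((k ^ 4).+1%:R / k%:R ^+ 2 + k%:R ^+ 2) <= 7 * k%:R ^+ 2 :> R.
  have : (k ^ 4).+1%:R / k%:R ^+ 2 <= 2 * k%:R ^+ 2 :> R.
    by rewrite ler_pdivrMr // -mulrA -exprD.
  lra.
have {}E1 := le_trans E1 (ler_pM (ler0n _ _) _ hk F1).
rewrite ler_pdivrMr ?exprn_gt0 //.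
have -> : 15 / k%:R ^+ 2 * k%:R ^+ 8 = 2 * k%:R ^+ 4 * (7 * k%:R ^+ 2) + k%:R ^+ 6 :> R.
  by field; rewrite lt0r_neq0.
apply: lerD.
  by apply: E1; rewrite addr_ge0 // mulr_ge0 // addr_ge0 ?divr_ge0 ?exprn_ge0.
rewrite natrX (_ : k%:R ^+ 6 = k%:R ^+ 2 * k%:R ^+ 4); last by ring.
rewrite ler_wpM2r ?exprn_ge0 //= ler_pdivrMr //; lra.
Qed.

End Annealed.

(** * Escape probability and speed *)

Section LastExit.
Variables (R : realFieldType) (sigma : int -> bool) (z : int).

Lemma hcount_cat b z' w1 w2 :
  hcount sigma b z' (w1 ++ w2) = (hcount sigma b z' w1 + hcount sigma b (z' + height w1) w2)%N.
Proof.
elim: w1 z' => [|s w IH] z' /=; first by rewrite height_nil addr0.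
by rewrite IH height_cons addrA addnA.
Qed.

Lemma xdisp_cat z' w1 w2 :
  xdisp sigma z' (w1 ++ w2) = xdisp sigma z' w1 + xdisp sigma (z' + height w1) w2.
Proof. by rewrite /xdisp !hcount_cat; lia. Qed.

Lemma at_origin_cat w1 w2 : at_origin sigma z w1 ->
  at_origin sigma z (w1 ++ w2) = at_origin sigma z w2.
Proof.
case/andP => /eqP h1 /eqP h2.
by rewrite /at_origin xdisp_cat height_cat h1 h2 !add0r addr0.
Qed.

Definition no_return (w : seq int) : bool :=
  ~~ has (fun k => at_origin sigma z (take k w)) (iota 1 (size w)).

Definition escape (n : nat) : R := mean lazy_steps n (fun w => (no_return w)%:R).

Lemma no_return_catl w1 w2 : no_return (w1 ++ w2) -> no_return w1.
Proof.
apply: contra => /hasP[k]; rewrite mem_iota => /andP[k1 k2] h.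
apply/hasP; exists k; first by rewrite mem_iota size_cat; lia.
by rewrite takel_cat //; lia.
Qed.

Lemma escape_mono m n : (m <= n)%N -> escape n <= escape m.
Proof.
move=> mn; rewrite /escape -(subnKC mn) mean_cat; apply: le_mean => // w1 _.
apply: mean_leC => // w2 _; have := @no_return_catl w1 w2.
by case: no_return => [->|_] //; rewrite ler0n.
Qed.

(** Decomposition at the last visit up to time [n]: a visit brings the walk back to row [z], so the
    remaining letters meet the same signs. *)
Lemma last_exit (n : nat) : 1 <= \sum_(i < n.+1) return_prob R sigma z i * escape (n - i).
Proof.
have -> : \sum_(i < n.+1) return_prob R sigma z i * escape (n - i) =
  mean lazy_steps n (fun w => \sum_(i < n.+1)
     (at_origin sigma z (take i w))%:R * (no_return (drop i w))%:R).
  rewrite mean_sum; apply: eq_bigr => i _.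
  have hi : (i <= n)%N by rewrite -ltnS.
  move: (nat_of_ord i) hi => {}i hi.
  rewrite -[in RHS](subnKC hi) mean_cat /return_prob -meanZr; apply: eq_mean => w1.
  rewrite mem_words => /andP[/eqP s1 _]; rewrite /escape -meanZ; apply: eq_mean => w2 _.
  by rewrite take_size_cat // drop_size_cat.
rewrite -[X in X <= _](mean_const (A := lazy_steps) isT n 1); apply: le_mean => // w.
rewrite mem_words => /andP[/eqP sw _].
pose good i := (i <= n)%N && at_origin sigma z (take i w).
have ex : exists i, good i.
  by exists 0%N; rewrite /good take0 /at_origin height_nil eqxx.
have ub i : good i -> (i <= n)%N by case/andP.
case: (ex_maxnP ex ub) => i /andP[hi ai] imax.
have hi' : (i < n.+1)%N by [].
rewrite (bigD1 (Ordinal hi')) //= ai (_ : no_return _ = true).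
  by rewrite /= mulr1 lerDl sumr_ge0 // => j _; rewrite mulr_ge0.
apply/hasPn => k; rewrite mem_iota size_drop sw => /andP[k1 k2].
apply/negP => hk; have : good (i + k)%N.
  rewrite /good -{1}(cat_take_drop i w) take_cat size_takel ?sw // ltnNge leq_addr /= addKn.
  by rewrite at_origin_cat // hk andbT; lia.
by move/imax; lia.
Qed.

End LastExit.

(** Beyond some [N'] the return probabilities sum to at most [1/2], so the last visit happens before
    [N'] with probability at least [1/2]. *)
Lemma escape_bounded_below (R : realType) (sigma : int -> bool) (z : int) (B : R) :
  (forall N, \sum_(n < N) return_prob R sigma z n <= B) ->
  exists2 c : R, 0 < c & forall n, c <= escape R sigma z n.
Proof.
move=> hB; pose S N := \sum_(n < N) return_prob R sigma z n.
have u0 n : 0 <= return_prob R sigma z n by apply: mean_ge0.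
have e1 n : escape R sigma z n <= 1 by apply: mean_leC => // w _; rewrite lern1 leq_b1.
have hs : has_sup (range S).
  by split; [exists (S 0%N); exists 0%N | exists B => _ [N _ <-]; exact: hB].
have [_ [N' _ <-] hN'] : exists2 y, range S y & sup (range S) - 2^-1 < y.
  by apply: sup_adherent => //; rewrite invr_gt0.
exists (2 * N'.+1%:R)^-1 => [|J]; first by rewrite invr_gt0 mulr_gt0.
(* With total time [N' + J], at least [J] steps follow a last visit before [N'], so each early term
   is at most [escape J]. *)
have := last_exit R sigma z (N' + J).
rewrite -(big_mkord xpredT (fun i => return_prob R sigma z i * escape R sigma z (N' + J - i))).
rewrite (@big_cat_nat _ _ _ N') //=; last by lia.
have h1 : \sum_(0 <= i < N') return_prob R sigma z i * escape R sigma z (N' + J - i) <=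
    N'%:R * escape R sigma z J.
  rewrite big_mkord; apply: (@le_trans _ _ (\sum_(i < N') escape R sigma z J)).
    apply: ler_sum => i _.
    apply: (@le_trans _ _ (escape R sigma z (N' + J - i))).
      rewrite ler_piMl //; first exact: mean_ge0.
      by apply: mean_leC => // w _; rewrite lern1 leq_b1.
    by apply: escape_mono; have := ltn_ord i; lia.
  by rewrite sumr_const card_ord -[_ *+ N']mulr_natl.
have h2 : \sum_(N' <= i < (N' + J).+1) return_prob R sigma z i * escape R sigma z (N' + J - i)
   <= 2^-1.
  apply: (@le_trans _ _ (\sum_(N' <= i < (N' + J).+1) return_prob R sigma z i)).
    by apply: ler_sum => i _; rewrite ler_piMr.
  have : S (N' + J).+1 <= sup (range S) by apply: sup_upper_bound => //; exists (N' + J).+1.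
  have -> : S (N' + J).+1 = S N' + \sum_(N' <= i < (N' + J).+1) return_prob R sigma z i.
    rewrite /S -!(big_mkord xpredT (return_prob R sigma z)).
    by rewrite (@big_cat_nat _ _ _ N') //=; lia.
  move=> h; rewrite -(lerD2l (S N')); apply: le_trans h _.
  by rewrite -lerBlDr ltW.
move=> /le_trans /(_ (lerD h1 h2)) h3; have e0 : 0 <= escape R sigma z J by apply: mean_ge0.
rewrite invfM ler_pdivrMr ?ltr0n //; rewrite -[N'.+1%:R]natr1; lra.
Qed.

(** Convergence holds along [k^4] because the squares are summable; in between, bounded increments
    move [x] by order [k^3], negligible against [k^4]. *)
Lemma cvg_speed0 (R : realType) (x : nat -> int) (B : R) :
  (forall n, `|x n.+1 - x n| <= 1) ->
  (forall N, \sum_(k < N) (x (k.+1 ^ 4)%N)%:~R ^+ 2 / k.+1%:R ^+ 8 <= B) ->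
  (fun n => (x n)%:~R / n%:R : R) @ \oo --> (0 : R).
Proof.
move=> x1 hB.
have x1' m n : (m <= n)%N -> `|x n - x m| <= (n - m)%N%:Z.
  move=> /subnKC <-; rewrite addKn; elim: (n - m)%N => [|i IH]; first by rewrite addn0 subrr.
  by have := x1 (m + i)%N; rewrite addnS; move: IH; lia.
pose u k : R := (x (k.+1 ^ 4)%N)%:~R ^+ 2 / k.+1%:R ^+ 8.
have u0 k : 0 <= u k by rewrite divr_ge0 ?sqr_ge0 ?exprn_ge0.
have cu : u @ \oo --> (0 : R).
  apply: cvg_series_cvg_0; apply: nondecreasing_is_cvgn.
    by apply: nondecreasing_series => n _.
  by exists B => _ [N _ <-]; rewrite /series /= big_mkord; exact: hB.
apply/cvgrPdist_le => e e0.
have e2 : 0 < (e / 2) ^+ 2 by rewrite exprn_gt0 // divr_gt0.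
move/cvgrPdist_le: cu => /(_ _ e2) [K1 _ hK1].
(* From [k >= 30 / e] on, the increment bound [15 k^3] is at most [e / 2 * k^4]. *)
have [K2 hK2] : exists K2 : nat, 30 / e <= K2%:R.
  by exists (Num.truncn (30 / e)).+1; rewrite ltW // truncnS_gt.
exists ((K1 + K2).+1 ^ 4)%N => // n /= hn.
rewrite sub0r normrN.
have exk : exists k, (k ^ 4 <= n)%N by exists 0%N.
have ubk k : (k ^ 4 <= n)%N -> (k <= n)%N.
  by move=> h; apply: leq_trans h; case: k => // k; rewrite -[X in (X <= _)%N]expn1 leq_pexp2l.
case: (ex_maxnP exk ubk) => k hk kmax.
have kK : (K1 + K2 < k)%N by apply: kmax.
have nk : (n < k.+1 ^ 4)%N by rewrite ltnNge; apply/negP => /kmax; rewrite ltnn.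
have k0 : (0 < k)%N by lia.
have kR : 0 < k%:R :> R by rewrite ltr0n.
have nR : 0 < n%:R :> R by rewrite ltr0n (leq_trans _ hk) // expn_gt0 k0.
have k4 : k%:R ^+ 4 <= n%:R :> R by rewrite -natrX ler_nat.
have hxk : `|(x (k ^ 4)%N)%:~R| <= e / 2 * k%:R ^+ 4.
  have := hK1 k.-1; rewrite /= sub0r normrN ger0_norm // /u prednK // => /(_ _).
  have -> : (K1 <= k.-1)%N by lia.
  move=> /(_ isT); rewrite ler_pdivrMr ?exprn_gt0 // (_ : k%:R ^+ 8 = (k%:R ^+ 4) ^+ 2).
    rewrite -exprMn -real_normK ?num_real // ler_pXn2r // nnegrE ?mulr_ge0 ?exprn_ge0 ?invr_ge0 //.
    exact: ltW.
  by rewrite -exprM.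
have dx : `|(x n - x (k ^ 4)%N)%:~R| <= 15 * k%:R ^+ 3 :> R.
  (* [15 = 4 + 6 + 4 + 1] bounds the expansion of [(k + 1)^4 - k^4]. *)
  have h15 : (n - k ^ 4 <= 15 * k ^ 3)%N.
    rewrite leq_subLR; apply: ltnW; apply: leq_trans nk _.
    rewrite -(ler_nat R) natrD natrM !natrX -natr1; have : 1 <= k%:R :> R by rewrite ler1n.
    move: k%:R => y y1; rewrite -subr_ge0.
    rewrite (_ : _ - _ = (y - 1) * (11 * y ^+ 2 + 5 * y + 1)); last by ring.
    by rewrite mulr_ge0 ?subr_ge0 // !addr_ge0 ?mulr_ge0 ?sqr_ge0 //; lra.
  have := x1' _ _ hk; rewrite -(ler_int R) intr_norm => /le_trans; apply.
  by rewrite -natrX -natrM ler_nat.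
rewrite normrM normfV [ `|n%:R| ]ger0_norm // ler_pdivrMr //.
have -> : (x n)%:~R = (x (k ^ 4)%N)%:~R + (x n - x (k ^ 4)%N)%:~R :> R.
  by rewrite intrB addrC subrK.
apply: le_trans (ler_normD _ _) _.
apply: le_trans (lerD hxk dx) _.
apply: (@le_trans _ _ (e * k%:R ^+ 4)); last by rewrite ler_wpM2l // ltW.
have : 15 <= e / 2 * k%:R.
  move: hK2; rewrite ler_pdivrMr // => hK2.
  have : K2%:R <= k%:R :> R by rewrite ler_nat; lia.
  by move=> /(ler_wpM2r (ltW e0)); lra.
move=> /(ler_wpM2r (exprn_ge0 3 (ltW kR))).
have -> : e / 2 * k%:R * k%:R ^+ 3 = e / 2 * k%:R ^+ 4 by ring.
lra.
Qed.

(** * Almost sure statements *)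

Section SimpleFunctions.
Context {R : realType} {d : measure_display} {T : measurableType d} (P : probability T R).

(** By monotone convergence the sum of the series has expectation at most [D], hence is finite
    almost everywhere. *)
Lemma ae_bounded_series (g : nat -> T -> R) (D : R) :
  (forall k t, 0 <= g k t) -> (forall k, measurable_fun setT (g k)) ->
  (forall N, \sum_(k < N) \int[P]_t (g k t)%:E <= D%:E)%E ->
  {ae P, forall t, exists B : R, forall N, \sum_(k < N) g k t <= B}.
Proof.
move=> g0 mg gD; pose S (t : T) : \bar R := (\sum_(0 <= k <oo) (g k t)%:E)%E.
have mS : measurable_fun setT S.
  apply: (@ge0_emeasurable_sum _ _ _ _ (fun k t => (g k t)%:E) xpredT).
    by move=> k t _ _; rewrite lee_fin.
  by move=> k _; apply/measurable_EFinP.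
have S0 t : (0 <= S t)%E by apply: nneseries_ge0 => k _ _; rewrite lee_fin.
have iS : P.-integrable setT S.
  apply/integrableP; split => //.
  apply: (@le_lt_trans _ _ D%:E); last exact: ltry.
  rewrite (eq_integral S) => [|t _]; last by rewrite gee0_abs.
  rewrite integral_nneseries //; last 2 first.
  - by move=> k; apply/measurable_EFinP.
  - by move=> k t _; rewrite lee_fin.
  apply: lime_le.
    by apply: is_cvg_nneseries => k _ _; apply: integral_ge0 => t _; rewrite lee_fin.
  by apply: nearW => N; rewrite big_mkord.
have := integrable_ae measurableT iS.
apply: filterS => t /(_ I) St; exists (fine (S t)) => N.
rewrite -lee_fin fineK // -sumEFin -(big_mkord xpredT (fun k => (g k t)%:E)).
by apply: nneseries_lim_ge => k _ _; rewrite lee_fin.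
Qed.

Variables (V : eqType) (A : seq V) (n : nat) (C : seq V -> set T).
Hypothesis A0 : (0 < size A)%N.
Hypothesis mC : forall w, measurable (C w).
Hypothesis PC : forall w, w \in words A n -> P (C w) = ((size A)%:R^-1 ^+ n)%:E.

(** For disjoint events [C w] this is [F] evaluated at the random word. It is used both for the
    signs of the environment and for the letters of the walk. *)
Definition cylinder_fun (F : seq V -> R) (t : T) : R :=
  \sum_(w <- words A n) F w * \1_(C w) t.

Lemma measurable_cylinder_fun F : measurable_fun setT (cylinder_fun F).
Proof.
apply: measurable_sum => w; apply: measurable_funM; first exact: measurable_cst.
exact: measurable_indic.
Qed.

Lemma cylinder_fun_ge (F : seq V -> R) (w : seq V) (t : T) :
  (forall w, 0 <= F w) -> w \in words A n -> C w t -> F w <= cylinder_fun F t.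
Proof.
move=> F0 wn Ct; have := @le_sum_mem R _ _ (fun w => F w * \1_(C w) t) w _ wn.
by rewrite indicE mem_set // mulr1; apply => w'; rewrite mulr_ge0.
Qed.

Lemma integral_cylinder_fun (F : seq V -> R) : (forall w, 0 <= F w) ->
  (\int[P]_t (cylinder_fun F t)%:E = (mean A n F)%:E)%E.
Proof.
move=> F0; under eq_integral do rewrite /cylinder_fun -sumEFin.
rewrite ge0_integral_sum //; last 2 first.
- move=> w; apply/measurable_EFinP; apply: measurable_funM; first exact: measurable_cst.
  exact: measurable_indic.
- by move=> w t _; rewrite lee_fin mulr_ge0.
rewrite /mean mulr_suml -sumEFin big_seq [RHS]big_seq; apply: eq_bigr => w wn.
under eq_integral do rewrite EFinM.
rewrite ge0_integralZl_EFin //; last first.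
  by apply/measurable_EFinP; exact: measurable_indic.
by rewrite integral_indic // setIT [X in (_ * X)%E](PC wn) -EFinM exprVn.
Qed.

End SimpleFunctions.

(** * Events determined by a random word *)

Section Law.
Context {R : realType} {d : measure_display} {T : measurableType d} (P : probability T R).
Variables (V : choiceType) (A : seq V) (n : nat) (C : seq V -> set T).
Hypothesis uA : uniq A.
Hypothesis mC : forall w, measurable (C w).
Hypothesis PC : forall w, w \in words A n -> P (C w) = ((size A)%:R^-1 ^+ n)%:E.
Hypothesis disjC : forall w w' t, w \in words A n -> w' \in words A n ->
  C w t -> C w' t -> w = w'.

Definition words_event (E : pred (seq V)) : set T :=
  \bigcup_(w in [set` [seq w <- words A n | E w]]) C w.

Lemma measurable_words_event E : measurable (words_event E).
Proof. by apply: fin_bigcup_measurable => // *; exact: finite_seq. Qed.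

Lemma prob_words_event E : P (words_event E) = (mean A n (fun w => (E w)%:R))%:E.
Proof.
rewrite measure_fin_bigcup //; last 2 first.
- exact: finite_seq.
- move=> w w'; rewrite /= !mem_filter => /andP[_ hw] /andP[_ hw'] [t [h h']].
  exact: disjC h h'.
rewrite -fsbig_seq ?filter_uniq ?words_uniq // big_filter /mean mulr_suml -sumEFin.
rewrite big_seq_cond [RHS]big_seq [RHS](bigID E) /= [X in (_ + X)%E]big1 ?adde0.
  by apply: eq_bigr => w /andP[hw hE]; rewrite hE mul1r PC // exprVn.
by move=> w /andP[_ /negbTE ->]; rewrite mul0r.
Qed.

End Law.

(** * Law of the random environment *)

Section Environment.
Context {R : realType} {d : measure_display} {Omega : measurableType d} (P : probability Omega R).
Variable eps : int -> {RV P >-> int}.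
Hypothesis eps_indep : mutually_independent eps.
Hypothesis eps_law : forall y : int, P [set w | eps y w = 1] = (2^-1)%:E.

Definition sgn_env (w : Omega) (y : int) : bool := eps y w == 1.

(** The sign [false] is the complement of the value 1 rather than the value -1, so the cylinders
    over words of length [size W] cover all of [Omega], not just almost all. *)
Definition env_cyl (W : seq int) (b : seq bool) : set Omega :=
  \bigcap_(y in [set` W]) (eps y @^-1` (if env W b y then [set 1] else ~` [set 1])).

Lemma env_cylP W b w : env_cyl W b w <-> {in W, sgn_env w =1 env W b}.
Proof.
split=> h y yW; have := h y yW; rewrite /sgn_env /=.
  by case: (env W b y) => /= [->|/eqP/negbTE->]; rewrite ?eqxx.
by case: (env W b y) => /= [/eqP|/negbT/eqP].
Qed.

Lemma measurable_env_cyl W b : measurable (env_cyl W b).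
Proof.
apply: fin_bigcap_measurable; first exact: finite_seq.
by move=> y _; apply: measurable_funPTI.
Qed.

Lemma prob_env_cyl (W : seq int) (b : seq bool) : uniq W ->
  P (env_cyl W b) = ((size [:: true; false])%:R^-1 ^+ size W)%:E.
Proof.
move=> uW; pose A y : set int := if env W b y then [set 1] else ~` [set 1].
have iA y : measurable (A y) by [].
have := @eps_indep [fset y in W]%fset A iA.
have -> : [set` [fset y in W]%fset] = [set` W].
  by apply/seteqP; split => y /=; rewrite inE.
move=> ->.
have pW : perm_eq [fset y in W]%fset W.
  by apply: uniq_perm => // y; rewrite inE.
rewrite (perm_big _ pW) /= (eq_bigr (fun=> (2^-1)%:E)) => [|y _].
  by elim: (W) => [|y W' IH]; rewrite ?big_nil ?big_cons //= IH exprS EFinM.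
have e1 : P (eps y @^-1` [set 1]) = (2^-1)%:E by exact: eps_law.
rewrite /A; case: (env W b y) => //.
rewrite -preimage_setC probability_setC; last exact: measurable_funPTI.
by rewrite e1 -EFinB; congr (_%:E); lra.
Qed.

Lemma map_env (W : seq int) (b : seq bool) : uniq W -> size b = size W ->
  map (env W b) W = b.
Proof.
move=> uW sb; apply: (@eq_from_nth _ false); rewrite size_map // => i iW.
by rewrite (nth_map 0) // /env index_uniq.
Qed.

Lemma env_map (W : seq int) (s : int -> bool) : {in W, env W (map s W) =1 s}.
Proof. by move=> y yW; rewrite /env (nth_map 0) ?index_mem // nth_index. Qed.

Variables (W : seq int) (g : (int -> bool) -> R).
Hypothesis uW : uniq W.
Hypothesis gW : forall s s', {in W, s =1 s'} -> g s = g s'.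

(** A function of finitely many signs is a finite combination of indicators of cylinders, which
    yields its measurability and its integral. *)
Lemma sgn_env_cylinder_fun :
  (fun w => g (sgn_env w)) =
  cylinder_fun [:: true; false] (size W) (env_cyl W) (fun b => g (env W b)).
Proof.
apply/funext => w; rewrite /cylinder_fun; pose b0 := map (sgn_env w) W.
have b0W : b0 \in words [:: true; false] (size W).
  by rewrite mem_words size_map eqxx; apply/allP => -[].
rewrite (bigD1_seq b0) ?words_uniq //= big1_seq ?addr0 => [|b /andP[bb0 bW]].
  rewrite indicE mem_set ?mulr1; first by apply: gW => y yW; rewrite env_map.
  by apply/env_cylP => y yW; rewrite env_map.
rewrite indicE memNset ?mulr0 // => /env_cylP h; case/eqP: bb0.
move: bW; rewrite mem_words => /andP[/eqP sb _].
by rewrite -(map_env uW sb) /b0; apply/esym/eq_in_map.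
Qed.

Lemma measurable_sgn_env : measurable_fun setT (fun w => g (sgn_env w)).
Proof.
by rewrite sgn_env_cylinder_fun; apply: measurable_cylinder_fun => b; apply: measurable_env_cyl.
Qed.

Lemma integral_sgn_env : (forall s, 0 <= g s) ->
  (\int[P]_w (g (sgn_env w))%:E =
   (mean [:: true; false] (size W) (fun b => g (env W b)))%:E)%E.
Proof.
move=> g0; have -> : (fun w => (g (sgn_env w))%:E) = (fun w => (cylinder_fun [:: true; false]
    (size W) (env_cyl W) (fun b => g (env W b)) w)%:E).
  by apply/funext => w; rewrite -(congr1 (@^~ w) sgn_env_cylinder_fun).
apply: integral_cylinder_fun => // b; first exact: measurable_env_cyl.
by move=> _; apply: prob_env_cyl.
Qed.

End Environment.

(** * Law of the walk in a fixed environment *)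

Section Chain.
Context {R : realType} {d : measure_display} {T : measurableType d} (Q : probability T R).
Variables (e : int -> int) (sigma : int -> bool) (x : int * int).
Variable M : nat -> {RV Q >-> (int * int)%type}.
Hypothesis e_sigma : forall y, e y = sgnb (sigma y).
Hypothesis chainM : markov_chain (srw_transition R e) x M.

Definition pos (w : seq int) : int * int := (x.1 + xdisp sigma x.2 w, x.2 + height w).

Definition follow (w : seq int) : set T :=
  [set t | forall k, (k <= size w)%N -> M k t = pos (take k w)].

Lemma measurable_set1_intint (u : int * int) : measurable [set u].
Proof.
have -> : [set u] = [set u.1] `*` [set u.2].
  by case: u => a b; apply/seteqP; split => [[? ?] [-> ->]|[? ?] [/= -> ->]].
by apply: measurableX.
Qed.

Lemma measurable_follow w : measurable (follow w).
Proof.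
have -> : follow w = \bigcap_(k in `I_(size w).+1) (M k @^-1` [set pos (take k w)]).
  by apply/seteqP; split => t h k; exact: h.
apply: fin_bigcap_measurable; first exact: finite_II.
by move=> k _; apply: measurable_funPTI; apply: measurable_set1_intint.
Qed.

Lemma pos_rcons w s : s \in lazy_steps ->
  srw_transition R e (pos w) (pos (rcons w s)) = 3^-1.
Proof.
move=> sl; rewrite /srw_transition (_ : oriented_edge _ _ _ = true) //.
rewrite /pos -cats1 xdisp_cat height_cat /xdisp /= height_cons height_nil addr0 addn0.
rewrite /oriented_edge /= e_sigma.
move: sl; rewrite !inE => /or3P[] /eqP -> /=.
- by apply/orP; left; apply/andP; split; [|apply/orP; left]; apply/eqP; lia.
- by apply/orP; left; apply/andP; split; [|apply/orP; right]; apply/eqP; lia.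
- apply/orP; right; apply/andP; split; apply/eqP; first lia.
  by case: (sigma _) => /=; lia.
Qed.

Lemma prob_follow n w : w \in words lazy_steps n ->
  Q (follow w) = ((size lazy_steps)%:R^-1 ^+ n)%:E.
Proof.
rewrite mem_words => /andP[/eqP <-]; have [M0 MS] := chainM.
elim/last_ind: w => [_|w s IH].
  rewrite expr0 -[RHS]M0; congr (Q _); apply/seteqP; split => t /=.
    by move/(_ 0%N isT) => ->; rewrite /pos /xdisp /= height_nil !addr0; case: (x).
  move=> h k; rewrite leqn0 => /eqP ->; rewrite h /pos /xdisp /= height_nil !addr0.
  by case: (x).
rewrite all_rcons => /andP[sl aw]; rewrite size_rcons.
have := MS (size w) (fun k => pos (take k (rcons w s))).
have -> : [set t | forall k, (k <= (size w).+1)%N -> M k t = pos (take k (rcons w s))] =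
    follow (rcons w s) by rewrite /follow size_rcons.
have -> : [set t | forall k, (k <= size w)%N -> M k t = pos (take k (rcons w s))] = follow w.
  by apply/seteqP; split => t h k kw; rewrite h // -cats1 takel_cat.
move=> ->; rewrite IH //.
have -> : take (size w).+1 (rcons w s) = rcons w s by rewrite -(size_rcons w s) take_size.
have -> : take (size w) (rcons w s) = w by rewrite -cats1 take_size_cat.
by rewrite pos_rcons // -EFinM exprSr.
Qed.

(** The letters are the increments of the vertical coordinate. *)
Lemma follow_inj n w w' t : w \in words lazy_steps n -> w' \in words lazy_steps n ->
  follow w t -> follow w' t -> w = w'.
Proof.
rewrite !mem_words => /andP[/eqP sw _] /andP[/eqP sw' _] h h'.
have hk k : (k <= n)%N -> height (take k w) = height (take k w').
  move=> kn; have := h k; have := h' k; rewrite sw sw' => /(_ kn) -> /(_ kn).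
  by case=> _ /addrI.
apply: (@eq_from_nth _ 0); rewrite sw // => i iw.
have tw : take i.+1 w = rcons (take i w) (nth 0 w i) by apply: take_nth; rewrite sw.
have tw' : take i.+1 w' = rcons (take i w') (nth 0 w' i) by apply: take_nth; rewrite sw'.
have := hk i.+1 iw; rewrite tw tw' -!cats1 !height_cat (hk i (ltnW iw)) => /addrI.
by rewrite !height_cons height_nil !addr0.
Qed.

(** The disjoint events of the words of length [n] have total probability 1. *)
Lemma ae_follow : {ae Q, forall t, forall n, exists2 w, w \in words lazy_steps n & follow w t}.
Proof.
apply: ae_foralln => n.
pose F := words_event lazy_steps n follow xpredT.
have mF : measurable F by apply: measurable_words_event => w; apply: measurable_follow.
have QF : Q F = 1%E.
  rewrite /F (prob_words_event _ measurable_follow (@prob_follow n) (@follow_inj n)) //.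
  by rewrite mean_const.
have QFc : Q (~` F) = 0%E by rewrite probability_setC // QF subee.
exists (~` F); split; [exact: measurableC | exact: QFc |].
move=> t /= h [w]; rewrite /= mem_filter => /andP[_ wn] hw; apply: h.
by exists w.
Qed.

(** The events [Dn n] of no return within [n] steps decrease to the event of no return and keep
    probability at least [c]. The graph is invariant under horizontal translation, so only the row
    [x.2] enters. *)
Lemma transient_of_return_prob (B : R) :
  (forall N, \sum_(n < N) return_prob R sigma x.2 n <= B) ->
  (Q [set t | exists n, M n.+1 t = x] < 1)%E.
Proof.
move=> /escape_bounded_below [c c0 hc].
set Ret := [set t | _].
pose Dn n : set T := \bigcap_(k in `I_n) (M k.+1 @^-1` (~` [set x])).
have mD n : measurable (Dn n).
  apply: fin_bigcap_measurable; first exact: finite_II.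
  move=> k _; apply: measurable_funPTI; apply: measurableC.
  exact: measurable_set1_intint.
have capD : \bigcap_n Dn n = ~` Ret.
  apply/seteqP; split => t /=.
    move=> h [n hn]; exact: (h n.+1 I n (ltnSn n)).
  by move=> h n _ k _ hk; apply: h; exists k.
have mRet : measurable Ret.
  rewrite -[Ret]setCK -capD; apply: measurableC; apply: bigcapT_measurable => n.
  exact: mD.
have hD n : (c%:E <= Q (Dn n))%E.
  apply: (@le_trans _ _ (escape R sigma x.2 n)%:E); first by rewrite lee_fin.
  rewrite -(prob_words_event _ measurable_follow (@prob_follow n) (@follow_inj n)) //.
  apply: le_measure; rewrite ?inE //.
    by apply: measurable_words_event => w; apply: measurable_follow.
  move=> t [w]; rewrite /= mem_filter mem_words => /andP[hw /andP[/eqP sw _]] ht k.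
  move=> /= kn Mk; move/hasPn: hw => /(_ k.+1).
  rewrite mem_iota sw add1n ltnS /= => /(_ kn); apply/negP; rewrite negbK.
  have := ht k.+1; rewrite sw Mk => /(_ kn); rewrite /pos /at_origin.
  case: (x) => a b /= [h1 h2]; apply/andP; split; apply/eqP; lia.
have cD : (c%:E <= Q (~` Ret))%E.
  rewrite -capD.
  have cvgD : Q \o Dn @ \oo --> Q (\bigcap_n Dn n).
    apply: nonincreasing_cvg_mu => //.
    - by rewrite (le_lt_trans (probability_le1 _ (mD 0%N))) // ltry.
    - exact: bigcapT_measurable.
    - move=> m n mn; apply/subsetPset => t h k /= km.
      by apply: h; apply: leq_trans km mn.
  rewrite -(cvg_lim _ cvgD) //; apply: lime_ge; first by apply/cvg_ex; exists (Q (\bigcap_n Dn n)).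
  by apply: nearW => n; exact: hD.
move: cD; rewrite probability_setC //.
have : Q Ret \is a fin_num by exact: fin_num_measure.
move/fineK <-; rewrite -EFinB lee_fin lte_fin; lra.
Qed.

End Chain.

(** * Dependence on finitely many signs *)

Lemma hcount_local (s s' : int -> bool) (b : bool) (z : int) (w : seq int) :
  {in heights z w, s =1 s'} -> hcount s b z w = hcount s' b z w.
Proof.
elim: w z => //= a w IH z h; rewrite IH => [|y yw]; last by apply: h; rewrite inE yw orbT.
by rewrite h ?mem_head.
Qed.

Lemma xdisp_local (s s' : int -> bool) (z : int) (w : seq int) :
  {in heights z w, s =1 s'} -> xdisp s z w = xdisp s' z w.
Proof. by move=> h; rewrite /xdisp !(hcount_local _ h). Qed.

Lemma lazy_heights_window (n N : nat) (z : int) (w : seq int) : (n <= N)%N ->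
  w \in words lazy_steps n -> {subset heights z w <= window z N}.
Proof.
move=> nN; rewrite mem_words => /andP[/eqP sw aw].
by apply: heights_window; rewrite // sw.
Qed.

Section Speed.
Variable R : realFieldType.

Definition sqr_speed (sigma : int -> bool) (k : nat) (w : seq int) : R :=
  ((xdisp sigma 0 w)%:~R ^+ 2 + (height w)%:~R ^+ 2) / k.+1%:R ^+ 8.

Definition mean_sqr_speed (sigma : int -> bool) (k : nat) : R :=
  mean lazy_steps (k.+1 ^ 4) (sqr_speed sigma k).

Lemma sqr_speed_ge0 sigma k w : 0 <= sqr_speed sigma k w.
Proof. by rewrite divr_ge0 ?exprn_ge0 // addr_ge0 ?sqr_ge0. Qed.

Lemma return_prob_local (s s' : int -> bool) (z : int) (n N : nat) : (n <= N)%N ->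
  {in window z N, s =1 s'} -> return_prob R s z n = return_prob R s' z n.
Proof.
move=> nN h; apply: eq_mean => w wn; rewrite /at_origin (@xdisp_local s s') //.
by move=> y yw; apply: h; apply: lazy_heights_window wn _ yw.
Qed.

Lemma mean_sqr_speed_local (s s' : int -> bool) (k : nat) :
  {in window 0 (k.+1 ^ 4), s =1 s'} -> mean_sqr_speed s k = mean_sqr_speed s' k.
Proof.
move=> h; apply: eq_mean => w wn; rewrite /sqr_speed (@xdisp_local s s') //.
by move=> y yw; apply: h; apply: lazy_heights_window wn _ yw.
Qed.

Lemma sum_inv_sqr_le (N : nat) : \sum_(k < N) 15 / k.+1%:R ^+ 2 <= 30 :> R.
Proof.
case: N => [|N]; first by rewrite big_ord0.
suff : \sum_(k < N.+1) 15 / k.+1%:R ^+ 2 <= 30 - 15 / N.+1%:R :> R.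
  by move/le_trans; apply; rewrite gerBl divr_ge0.
elim: N => [|N IH]; first by rewrite big_ord1 expr1n; lra.
rewrite big_ord_recr /=; apply: le_trans (lerD IH (lexx _)) _.
rewrite -[N.+2%:R]natr1; have : 0 < N.+1%:R :> R by rewrite ltr0n.
move: N.+1%:R => x x0; rewrite -subr_ge0.
rewrite (_ : _ - _ = 15 / (x * (x + 1) ^+ 2)); last by field; rewrite !lt0r_neq0 //; lra.
by rewrite divr_ge0 // mulr_ge0 ?sqr_ge0 // ltW.
Qed.

End Speed.

Lemma ae_forall_int (R : realType) (d : measure_display) (T : measurableType d)
    (P : probability T R) (A : int -> T -> Prop) :
  (forall y, {ae P, forall t, A y t}) -> {ae P, forall t, forall y, A y t}.
Proof.
move=> h; have : {ae P, forall t, forall n : nat, if (choice.unpickle n : option int) is Some y then A y t else True}.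
  by apply: ae_foralln => n; case: choice.unpickle => [y|]; [exact: h | apply: aeW].
by apply: filterS => t ht y; have := ht (choice.pickle y); rewrite choice.pickleK.
Qed.

Lemma ae_and (R : realType) (d : measure_display) (T : measurableType d)
    (P : probability T R) (A B : T -> Prop) :
  {ae P, forall t, A t} -> {ae P, forall t, B t} -> {ae P, forall t, A t /\ B t}.
Proof. exact: filterI. Qed.

(** * Properties of almost every environment *)

Section GoodEnvironment.
Context {R : realType} {d : measure_display} {Omega : measurableType d} (P : probability Omega R).
Variable eps : int -> {RV P >-> int}.
Hypothesis eps_indep : mutually_independent eps.
Hypothesis eps_law : forall y : int,
  P [set w | eps y w = 1] = (2^-1)%:E /\ P [set w | eps y w = -1] = (2^-1)%:E.

Let eps_law1 y : P [set w | eps y w = 1] = (2^-1)%:E := (eps_law y).1.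

(** [sgn_env] only tests for the value 1; the two probabilities sum to 1, which excludes values
    other than 1 and -1. *)
Lemma ae_sign : {ae P, forall w, forall y, eps y w = sgnb (sgn_env eps w y)}.
Proof.
apply: ae_forall_int => y.
pose A1 : set Omega := eps y @^-1` [set 1]; pose A2 : set Omega := eps y @^-1` [set -1].
pose A := A1 `|` A2.
have m1 : measurable A1 by apply: measurable_funPTI.
have m2 : measurable A2 by apply: measurable_funPTI.
have mA : measurable A by exact: measurableU.
have PA : P A = 1%E.
  have PU : (P A = P A1 + P A2)%E.
    by apply: measureU => //; apply/seteqP; split => w // [h1 h2]; move: h2; rewrite /A2 /= h1.
  have e1 : P A1 = (2^-1)%:E := (eps_law y).1.
  have e2 : P A2 = (2^-1)%:E := (eps_law y).2.
  by rewrite PU e1 e2 -EFinD; congr (_%:E); lra.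
have PAc : P (~` A) = 0%E by rewrite probability_setC // PA subee.
exists (~` A); split; [exact: measurableC | exact: PAc |].
move=> w /= h hA; apply: h; rewrite /sgn_env.
by case: hA => /= ->.
Qed.

Lemma ae_return_prob : {ae P, forall w, forall z, exists B : R, forall N,
  \sum_(n < N) return_prob R (sgn_env eps w) z n <= B}.
Proof.
apply: ae_forall_int => z; have [D HD] := annealed_green_bounded R.
apply: (@ae_bounded_series _ _ _ P (fun n w => return_prob R (sgn_env eps w) z n) D).
- by move=> n w; apply: mean_ge0.
- move=> n; apply: (@measurable_sgn_env _ _ _ _ _ (window z n) (fun s => return_prob R s z n)).
    exact: window_uniq.
  by move=> s s'; apply: return_prob_local.
(* All terms with [n < N] are integrated over the common window [window z N], where the annealed
   bound is stated. *)
move=> N; apply: (@le_trans _ _ (mean [:: true; false] (size (window z N))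
   (fun b => \sum_(n < N) return_prob R (env (window z N) b) z n))%:E); last by rewrite lee_fin.
rewrite mean_sum -sumEFin; apply: lee_sum => n _.
rewrite (@integral_sgn_env _ _ _ _ _ eps_indep eps_law1 (window z N) (fun s => return_prob R s z n)) //.
- exact: window_uniq.
- by move=> s s'; apply: return_prob_local; rewrite ltnW.
- by move=> s; apply: mean_ge0.
Qed.

Lemma ae_mean_sqr_speed : {ae P, forall w, exists B : R, forall N,
  \sum_(k < N) mean_sqr_speed R (sgn_env eps w) k <= B}.
Proof.
apply: (@ae_bounded_series _ _ _ P (fun k w => mean_sqr_speed R (sgn_env eps w) k) 30).
- by move=> k w; apply: mean_ge0 => v _; apply: sqr_speed_ge0.
- move=> k; apply: (@measurable_sgn_env _ _ _ _ _ (window 0 (k.+1 ^ 4))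
    (fun s => mean_sqr_speed R s k)); first exact: window_uniq.
  by move=> s s'; apply: mean_sqr_speed_local.
move=> N; apply: (@le_trans _ _ (\sum_(k < N) 15 / k.+1%:R ^+ 2)%:E); last first.
  by rewrite lee_fin sum_inv_sqr_le.
rewrite -sumEFin; apply: lee_sum => k _.
rewrite (@integral_sgn_env _ _ _ _ _ eps_indep eps_law1 (window 0 (k.+1 ^ 4))
  (fun s => mean_sqr_speed R s k)); last 3 first.
- exact: window_uniq.
- by move=> s s'; apply: mean_sqr_speed_local.
- by move=> s; apply: mean_ge0 => v _; apply: sqr_speed_ge0.
rewrite lee_fin; apply: annealed_speed_bound => //; first exact: window_uniq.
by move=> w; apply: lazy_heights_window.
Qed.

End GoodEnvironment.

Lemma step_le1 (sigma : int -> bool) (z s : int) : s \in lazy_steps ->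
  `|xdisp sigma z [:: s]| <= 1 /\ `|height [:: s]| <= 1.
Proof.
rewrite /xdisp height_cons height_nil !inE => /or3P[] /eqP -> /=; case: (sigma z) => /=;
  by split; lia.
Qed.

(** The series argument is repeated with the environment fixed: under [Q] the variable [g k] has
    expectation [mean_sqr_speed R sigma k], and these are summable. *)
Lemma ae_speed0 (R : realType) (d : measure_display) (T : measurableType d)
    (Q : probability T R) (e : int -> int) (sigma : int -> bool)
    (M : nat -> {RV Q >-> (int * int)%type}) (B : R) :
  (forall y, e y = sgnb (sigma y)) -> markov_chain (srw_transition R e) (0, 0) M ->
  (forall N, \sum_(k < N) mean_sqr_speed R sigma k <= B) ->
  {ae Q, forall t,
    (fun n : nat => ((M n t).1%:~R / n%:R, (M n t).2%:~R / n%:R) : R * R)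
      @ \oo --> ((0, 0) : R * R)}.
Proof.
move=> e_sigma chainM hB.
have mF := measurable_follow sigma (0, 0) M.
have PF n := @prob_follow _ _ _ _ _ _ _ _ e_sigma chainM n.
pose g k := cylinder_fun lazy_steps (k.+1 ^ 4) (follow sigma (0, 0) M) (sqr_speed R sigma k).
have bd : {ae Q, forall t, exists B' : R, forall N, \sum_(k < N) g k t <= B'}.
  apply: (@ae_bounded_series _ _ _ Q g B).
  - by move=> k t; apply: sumr_ge0 => w _; rewrite mulr_ge0 ?sqr_speed_ge0.
  - by move=> k; apply: measurable_cylinder_fun.
  move=> N; apply: (@le_trans _ _ (\sum_(k < N) mean_sqr_speed R sigma k)%:E); last first.
    by rewrite lee_fin.
  rewrite -sumEFin; apply: lee_sum => k _.
  rewrite integral_cylinder_fun //; first exact: PF.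
  by move=> w; apply: sqr_speed_ge0.
have := ae_and bd (ae_follow e_sigma chainM); apply: filterS => t [[B' hB'] ft].
have step n : `|(M n.+1 t).1 - (M n t).1| <= 1 /\ `|(M n.+1 t).2 - (M n t).2| <= 1.
  have [w wn fw] := ft n.+1; move: wn; rewrite mem_words => /andP[/eqP sw aw].
  have wE : take n.+1 w = rcons (take n w) (nth 0 w n) by apply: take_nth; rewrite sw.
  have sl : nth 0 w n \in lazy_steps by apply: (allP aw); rewrite mem_nth ?sw.
  have := fw n.+1; rewrite sw => /(_ (leqnn _)) ->.
  have := fw n; rewrite sw => /(_ (leqnSn _)) ->.
  rewrite wE /pos -cats1 xdisp_cat height_cat /= !add0r.
  by have := step_le1 sigma (height (take n w)) sl; rewrite !(addrC (xdisp _ _ (take n w))) !(addrC (height (take n w))) !addrK.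
(* Either squared coordinate is dominated by the same series, so one bound serves for both. *)
have sumsq (f : int * int -> int) (N : nat) : (forall w, (f (pos sigma (0, 0) w))%:~R ^+ 2 <=
     (xdisp sigma 0 w)%:~R ^+ 2 + (height w)%:~R ^+ 2 :> R) ->
    \sum_(k < N) (f (M (k.+1 ^ 4)%N t))%:~R ^+ 2 / k.+1%:R ^+ 8 <= B' :> R.
  move=> hf; apply: le_trans (hB' N); apply: ler_sum => k _.
  have [w wn fw] := ft (k.+1 ^ 4)%N.
  apply: le_trans (cylinder_fun_ge (C := follow sigma (0, 0) M) (@sqr_speed_ge0 R sigma k) wn fw).
  have sw : size w = (k.+1 ^ 4)%N by move: wn; rewrite mem_words => /andP[/eqP].
  have := fw (k.+1 ^ 4)%N; rewrite -sw take_size => ->//.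
  by rewrite /sqr_speed ler_pM2r ?invr_gt0 ?exprn_gt0.
have c1 : (fun n : nat => (M n t).1%:~R / n%:R : R) @ \oo --> (0 : R).
  apply: (@cvg_speed0 R (fun n => (M n t).1) B') => [n|N]; first exact: (step n).1.
  by apply: (sumsq fst) => w; rewrite /= add0r lerDl sqr_ge0.
have c2 : (fun n : nat => (M n t).2%:~R / n%:R : R) @ \oo --> (0 : R).
  apply: (@cvg_speed0 R (fun n => (M n t).2) B') => [n|N]; first exact: (step n).2.
  by apply: (sumsq snd) => w; rewrite /= add0r lerDr sqr_ge0.
exact: (cvg_pair c1 c2).
Qed.

Theorem theorem1p8 (R : realType) (d : measure_display)
    (Omega : measurableType d) (P : probability Omega R)
    (eps : int -> {RV P >-> int})
    (eps_indep : mutually_independent eps)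
    (eps_law : forall y : int,
      P [set w | eps y w = 1] = (2^-1)%:E /\
      P [set w | eps y w = -1] = (2^-1)%:E) :
  {ae P, forall w,
    transient (srw_transition R (fun y => eps y w)) /\
    forall (d' : measure_display) (T : measurableType d')
      (Q : probability T R) (M : nat -> {RV Q >-> (int * int)%type}),
      markov_chain (srw_transition R (fun y => eps y w)) (0, 0) M ->
      {ae Q, forall t,
        (fun n : nat => ((M n t).1%:~R / n%:R, (M n t).2%:~R / n%:R) : R * R)
          @ \oo --> ((0, 0) : R * R)}}.
Proof.
(* The exceptional null set depends on the environment alone; off it, every starting point and every
   realisation of the chain is handled. *)
have := ae_and (ae_sign eps_law) (ae_and (ae_return_prob eps_indep eps_law)
  (ae_mean_sqr_speed eps_indep eps_law)).
apply: filterS => w [hs [hr [B hB]]]; split.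
  move=> x d' T Q M chainM; have [B' hB'] := hr x.2.
  exact (transient_of_return_prob hs chainM hB').
by move=> d' T Q M chainM; apply: ae_speed0 hs chainM hB.
Qed.
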